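(* Let $d\in\mathbb N$. For $z\in\mathbb R^d$ let $u^z(t,x)=(2\pi t)^{-d/2}\exp\big(-\frac{|x-z|^2}{2t}\big)$, $t>0$, and let $\mathbb W^z$ be the law on $C([0,\infty);\mathbb R^d)$ of $(z+W_t)_{t\ge0}$, where $W$ is a standard $d$-dimensional Brownian motion. Then $\{\mathbb W^z\}_{z\in\mathbb R^d}$ is a nonlinear Markov core for $\{u^z\}_{z\in\mathbb R^d}$.
   Context: Notation: $\mathbb R_+=[0,\infty)$; $\mathcal P(T)$ is the set of Borel probability measures on $T$, $\mathcal P=\mathcal P(\mathbb R^d)$. $\mathcal C=C(\mathbb R_+;\mathbb R^d)$ with locally uniform convergence and Borel $\sigma$-algebra, $\pi_t(w)=w(t)$, $\mathcal F_t=\sigma(\pi_s:s\le t)$, $\Pi_t(w)=w(t+\cdot)$, $P_t:=P\circ\pi_t^{-1}$ for $P\in\mathcal P(\mathcal C)$. Nonlinear Markov process: a family $\{P^\zeta\}_{\zeta\in\mathcal P_0}\subset\mathcal P(\mathcal C)$, $\mathcal P_0\subseteq\mathcal P$, such that with $\mu^\zeta_t:=P^\zeta_t$: (i) $\mu^\zeta_0=\zeta$; (ii) $\mu^\zeta_t\in\mathcal P_0$ for all $t>0$; (iii) for all $s,t\ge0$, $\zeta\in\mathcal P_0$, $A\in\mathcal B(\mathbb R^d)$: $P^\zeta(\pi_{t+s}\in A\mid\mathcal F_s)(\cdot)=P^{\mu^\zeta_s,\pi_s(\cdot)}(\pi_t\in A)$ $P^\zeta$-a.s., where $\{P^{\eta,y}\}_y$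 is the disintegration of $P^\eta$ with respect to $\pi_0$ (measurable in $y$, $P^\eta=\int P^{\eta,y}d\eta(y)$, $P^{\eta,y}(\pi_0=y)=1$ for $\eta$-a.e. $y$). Nonlinear Markov core: for $\{\mu^z_t\}_{t\ge0,z\in\mathbb R^d}\subset\mathcal P$ with $\mu^z_0=\delta_z$ and $(t,z)\mapsto\mu^z_t$ injective, $\{P^z\}_{z}\subset\mathcal P(\mathcal C)$ is a nonlinear Markov core for $\{\mu^z_t\}$ if $P^z_t=\mu^z_t$ for all $t\ge0$, $z\in\mathbb R^d$, and $\{P^\zeta\}_{\zeta\in\mathcal P_0}$, with $\mathcal P_0:=\{\mu^z_t:t\ge0,z\in\mathbb R^d\}$ and $P^\zeta:=P^z\circ\Pi_t^{-1}$ for $\zeta=\mu^z_t$, is a nonlinear Markov process. ''Core for $\{u^z\}$'' means with $\mu^z_t=u^z(t,x)dx$, $t>0$, $\mu^z_0=\delta_z$. *)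

(* Defs.v *)
From HB Require Import structures.
From mathcomp Require Import all_boot all_order all_algebra.
From mathcomp Require Import all_classical all_reals all_analysis.
From mathcomp Require Import measurable_realfun.

Set Implicit Arguments.
Unset Strict Implicit.
Unset Printing Implicit Defensive.

Import Order.TTheory GRing.Theory Num.Theory.
Import numFieldNormedType.Exports.

Local Open Scope classical_set_scope.
Local Open Scope ring_scope.

(* Borel sigma-algebra of R^d; the topology on ['rV[R]_d] is that of the sup
   norm, i.e. the usual one. *)
HB.instance Definition _ (R : realType) (d : nat) :=
  @isMeasurable.Build (@sigma_display 'rV[R]_d open) 'rV[R]_d
    <<s (open : set (set 'rV[R]_d)) >> (@sigma_algebra0 _ setT _)
    (@sigma_algebraC _ _) (@sigma_algebra_bigcup _ setT _).

Section borel_rV.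
Variables (R : realType).

Lemma open_measurable_rV d (O : set 'rV[R]_d) : open O -> measurable O.
Proof. by move=> oO; exact: sub_sigma_algebra. Qed.

Lemma coord_continuous_rV d (i : 'I_d) :
  continuous (fun v : 'rV[R]_d => v 0 i).
Proof. exact: coord_continuous. Qed.

Lemma measurable_coord_rV d (i : 'I_d) :
  measurable_fun [set: 'rV[R]_d] (fun v : 'rV[R]_d => v 0 i).
Proof.
apply: (measurability _ (RGenOpens.measurableE R)).
move=> _ [_ [a [b ->] <-]]; rewrite setTI.
apply: open_measurable_rV; apply: open_comp; last exact: interval_open.
by move=> x _; exact: coord_continuous_rV.
Qed.

Let box d (p : 'rV[rat]_d * nat) : set 'rV[R]_d :=
  [set v | forall i, `|v 0 i - ratr (p.1 0 i)| < p.2.+1%:R^-1].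

Lemma open_bigcup_box d (O : set 'rV[R]_d) : open O ->
  O = \bigcup_(p in [set p | box p `<=` O]) box p.
Proof.
move=> oO; apply/seteqP; split=> [v Ov|v [p /= + pv]]; last exact.
move: oO; rewrite openE => /(_ v Ov); rewrite /interior => -[/= P Pv PO].
have [e e0 eP] : exists2 e : R, 0 < e & forall w : 'rV[R]_d,
    (forall i, `|v 0 i - w 0 i| < e) -> O w.
  have : forall i, exists e : R, 0 < e /\ ball (v 0 i) e `<=` P 0 i.
    by move=> i; have /nbhs_ballP[e /= e0 ?] := Pv 0 i; exists e.
  move=> /choice[f fP].
  pose e := \big[Order.min/1]_(i < d) f i.
  exists e => [|w vw].
    by rewrite /e; elim/big_ind : _ => //= [x y x0 y0|i _];
      [rewrite lt_min x0|case: (fP i)].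
  apply: PO => /= i j; rewrite ord1; apply: (fP j).2.
  rewrite /ball /=; apply: (lt_le_trans (vw j)).
  by rewrite /e; exact: bigmin_le_cond.
have [n nP] : exists n : nat, n.+1%:R^-1 < e / 2.
  have [k _ /(_ k (leqnn k))] :=
    near_infty_natSinv_lt (PosNum (divr_gt0 e0 (ltr0n R 2))).
  by exists k.
have : forall i, exists q : rat, `|v 0 i - ratr q| < n.+1%:R^-1.
  move=> i.
  have [|q] := @rat_in_itvoo R (v 0 i - n.+1%:R^-1) (v 0 i + n.+1%:R^-1).
    by rewrite ltrD2l gtrN// invr_gt0.
  rewrite in_itv /= => /andP[h1 h2]; exists q.
  by rewrite distrC ltr_distl h1.
move=> /choice[q qP].
exists (\row_i q i, n); last by move=> i; rewrite mxE.
move=> w /= wq; apply: eP => i.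
rewrite -[X in X - _](subrK (ratr (q i))) -addrA.
rewrite (le_lt_trans (ler_normD _ _))// (splitr e) ltrD//.
  exact: lt_trans (qP i) nP.
by rewrite distrC; have := wq i; rewrite mxE => /lt_trans; exact.
Qed.

Lemma measurable_fun_rV d disp (T : measurableType disp) (f : T -> 'rV[R]_d) :
  (forall i, measurable_fun [set: T] (fun x => f x 0 i)) ->
  measurable_fun [set: T] f.
Proof.
move=> mf.
apply: (@measurability _ _ _ _ [set: T] f (open : set (set 'rV[R]_d))) => //.
move=> _ [U oU <-]; rewrite setTI (open_bigcup_box oU) preimage_bigcup.
rewrite bigcup_mkcond; apply: countable_bigcupT_measurable => //.
move=> p; case: ifPn => [_|_]; last exact: measurable0.
rewrite [X in measurable X](_ : _ = \bigcap_(i in [set: 'I_d])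
  ((fun x => f x 0 i) @^-1` [set r | `|r - ratr (p.1 0 i)| < p.2.+1%:R^-1])).
  apply: fin_bigcap_measurable => // i _; rewrite -[X in measurable X]setTI.
  apply: mf => //; apply: open_measurable.
  by rewrite (_ : [set _ | _] = ball_ Num.norm (ratr (p.1 0 i)) p.2.+1%:R^-1);
    [exact: ball_open|apply/funext => r; rewrite /ball_ /= distrC].
apply/seteqP; split=> x /=; first by move=> h i _; exact: h.
by move=> h i; exact: h.
Qed.

End borel_rV.

Section lebesgue_rV.
Variable R : realType.

Definition rV_cons n (p : measurableTypeR R * 'rV[R]_n) : 'rV[R]_n.+1 :=
  row_mx (const_mx p.1 : 'rV_1) p.2.

Lemma measurable_rV_cons n :
  measurable_fun [set: measurableTypeR R * 'rV[R]_n] (@rV_cons n).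
Proof.
apply: measurable_fun_rV => i.
have [j ->|j ->] := split_ordP (i : 'I_(1 + n)).
  rewrite (_ : (fun _ => _) = (fst : _ -> measurableTypeR R)).
    exact: measurable_fst.
  by apply/funext => p; rewrite /rV_cons [LHS]row_mxEl mxE.
rewrite (_ : (fun _ => _) = (fun v : 'rV_n => v 0 j) \o snd).
  by apply: measurableT_comp; [exact: measurable_coord_rV|exact: measurable_snd].
by apply/funext => p; rewrite /rV_cons [LHS]row_mxEr.
Qed.

HB.instance Definition _ n :=
  isMeasurableFun.Build _ _ _ _ (@rV_cons n) (@measurable_rV_cons n).

Section step.
Variables (n : nat) (m : {sigma_finite_measure set 'rV[R]_n -> \bar R}).

Definition lebesgue_rV_step : set 'rV[R]_n.+1 -> \bar R :=
  pushforward (lebesgue_measure \x m)%E (@rV_cons n).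

Let mcons_preimage A : measurable A -> measurable (@rV_cons n @^-1` A).
Proof.
by move=> mA; rewrite -[X in measurable X]setTI; exact: measurable_rV_cons.
Qed.

Let step0 : lebesgue_rV_step set0 = 0%E.
Proof. by rewrite /lebesgue_rV_step /pushforward preimage_set0 measure0. Qed.

Let step_ge0 A : (0 <= lebesgue_rV_step A)%E.
Proof. by rewrite /lebesgue_rV_step /pushforward measure_ge0. Qed.

Let step_sigma_additive : semi_sigma_additive lebesgue_rV_step.
Proof.
move=> F mF tF mUF; rewrite /lebesgue_rV_step /pushforward preimage_bigcup.
apply: measure_semi_sigma_additive.
- by move=> k; exact: mcons_preimage.
- apply/trivIsetP => i j _ _ ij; rewrite -preimage_setI.
  by move/trivIsetP : tF => -> //; rewrite preimage_set0.
- by rewrite -preimage_bigcup; exact: mcons_preimage.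
Qed.

HB.instance Definition _ := isMeasure.Build _ _ _ lebesgue_rV_step
  step0 step_ge0 step_sigma_additive.

Let sigma_finite_step : sigma_finite [set: 'rV[R]_n.+1] lebesgue_rV_step.
Proof.
have [F FT Foo] : sigma_finite setT (@lebesgue_measure R \x m)%E.
  have /sigma_finiteP[A [TA ndA Aoo]] := sigma_finiteT (@lebesgue_measure R).
  have /sigma_finiteP[B [TB ndB Boo]] := sigma_finiteT m.
  exists (fun k => A k `*` B k).
    rewrite -setXTT TA TB; apply/seteqP; split=> -[x y] /=.
      move=> [[i _ Ax] [j _ By]]; exists (maxn i j) => //; split.
        by move: x Ax; exact/subsetPset/ndA/leq_maxl.
      by move: y By; exact/subsetPset/ndB/leq_maxr.
    by move=> [k _ [/= Ax By]]; split; exists k.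
  move=> k; have [? ?] := Aoo k; have [? ?] := Boo k.
  split; first exact: measurableX.
  by rewrite product_measure1E// lte_mul_pinfty// ge0_fin_numE.
pose g (v : 'rV[R]_(1 + n)) : measurableTypeR R * 'rV[R]_n :=
  (v 0 (lshift n 0), rsubmx v).
have mg : measurable_fun [set: 'rV[R]_(1 + n)] g.
  apply/measurable_fun_pairP; split.
    exact: measurable_coord_rV.
  apply: measurable_fun_rV => i.
  rewrite (_ : (fun _ => _) = fun v : 'rV_(1 + n) => v 0 (rshift 1 i)).
    exact: measurable_coord_rV.
  by apply/funext => v; rewrite /= mxE.
have gK : cancel (@rV_cons n) g.
  move=> [x v]; rewrite /g /rV_cons row_mxKr; congr pair.
  by rewrite row_mxEl mxE.
exists (fun k => g @^-1` F k); first by rewrite -preimage_bigcup -FT.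
move=> k; have [mF Fk] := Foo k; split.
  by rewrite -[X in measurable X]setTI; exact: mg.
rewrite /lebesgue_rV_step /pushforward.
by rewrite (_ : _ @^-1` _ = F k)//; apply/seteqP; split=> p /=; rewrite gK.
Qed.

HB.instance Definition _ :=
  @Measure_isSigmaFinite.Build _ _ _ lebesgue_rV_step sigma_finite_step.

End step.

(* Lebesgue measure on R^n, as the n-fold product of the one on R: R^(n+1) is
   identified with R x R^n through [rV_cons]. *)
Fixpoint lebesgue_rV n : {sigma_finite_measure set 'rV[R]_n -> \bar R} :=
  if n is k.+1 then lebesgue_rV_step (lebesgue_rV k) else \d_(0 : 'rV[R]_0).

End lebesgue_rV.

Section half_line.
Variable R : realType.

Definition Rplus : Type := set_type [set t : R | 0 <= t].

HB.instance Definition _ := Uniform.copy Rplus (set_type [set t : R | 0 <= t]).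

Definition Rplus0 : Rplus := SigSub (mem_set (lexx 0 : [set t : R | 0 <= t] 0)).

Definition Rplus_add (s t : Rplus) : Rplus :=
  SigSub (mem_set (addr_ge0 (set_valP s) (set_valP t)
                   : [set r : R | 0 <= r] (set_val s + set_val t))).

Lemma Rplus_add_continuous (s : Rplus) : continuous (Rplus_add s).
Proof.
apply: continuous_comp_initial => t.
rewrite (_ : set_val \o Rplus_add s = (fun r => set_val s + r) \o set_val)//.
apply: continuous_comp; first exact: initial_continuous.
by apply: cvgD; [exact: cvg_cst|exact: cvg_id].
Qed.

End half_line.

Section path_space.
Variables (R : realType) (d : nat).

Definition cpath : Type := continuousType (Rplus R) 'rV[R]_d.

HB.instance Definition _ := Choice.on cpath.
(* Uniform convergence on compact sets, which is locally uniform convergence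
   since the half-line is locally compact. *)
HB.instance Definition _ := Uniform.copy cpath
  (initial_topology ((fun w : cpath => w : Rplus R -> 'rV[R]_d) :
     cpath -> {family compact, Rplus R -> 'rV[R]_d})).
HB.instance Definition _ :=
  isPointed.Build cpath (mkcts (@cst_continuous (Rplus R) 'rV[R]_d 0)).
HB.instance Definition _ :=
  @isMeasurable.Build (@sigma_display cpath open) cpath
    <<s (open : set (set cpath)) >> (@sigma_algebra0 _ setT _)
    (@sigma_algebraC _ _) (@sigma_algebra_bigcup _ setT _).

Lemma open_measurable_cpath (U : set cpath) : open U -> measurable U.
Proof. by move=> oU; exact: sub_sigma_algebra. Qed.

Lemma cpath_nbhs (w : cpath) (K : set (Rplus R))
    (E : set ('rV[R]_d * 'rV[R]_d)) :
  compact K -> entourage E ->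
  nbhs w [set w' : cpath | forall t, K t -> E (w t, w' t)].
Proof.
move=> cK entE.
have H := @initial_continuous cpath {family compact, Rplus R -> 'rV[R]_d}
  (fun w : cpath => w : Rplus R -> 'rV[R]_d).
exact: (H w _ (fam_nbhs _ entE cK)).
Qed.

Lemma cpath_continuous (T : topologicalType) (F : T -> cpath) :
  (forall x K E, compact K -> entourage E ->
    nbhs x [set y | forall t, K t -> E (F x t, F y t)]) ->
  continuous F.
Proof.
move=> hF; apply: continuous_comp_initial => x.
apply/fam_cvgP => K cK U /uniform_nbhs[E [entE EU]].
by apply: filterS (hF x K E cK entE) => y; exact: EU.
Qed.

Lemma eval_cpath_continuous (t : Rplus R) : continuous (fun w : cpath => w t).
Proof.
move=> w U; rewrite -nbhs_entourageE => -[E entE EU].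
apply: filterS (cpath_nbhs w (@compact_set1 _ t) entE) => w' h.
by apply: EU; apply/xsectionP; exact: h.
Qed.

Lemma measurable_continuous_cpath (F : cpath -> cpath) :
  continuous F -> measurable_fun [set: cpath] F.
Proof.
move=> cF; apply: (@measurability _ _ _ _ _ F (open : set (set cpath))) => //.
move=> _ [U oU <-]; rewrite setTI; apply: open_measurable_cpath.
by apply: open_comp => // w _; exact: cF.
Qed.

Definition eval_at (t : Rplus R) (w : cpath) : 'rV[R]_d := w t.

Lemma measurable_eval_at t : measurable_fun [set: cpath] (eval_at t).
Proof.
apply: (@measurability _ _ _ _ _ _ (open : set (set 'rV[R]_d))) => //.
move=> _ [U oU <-]; rewrite setTI; apply: open_measurable_cpath.
by apply: open_comp => // w _; exact: eval_cpath_continuous.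
Qed.

HB.instance Definition _ t :=
  isMeasurableFun.Build _ _ _ _ (eval_at t) (measurable_eval_at t).

Lemma time_shift_subproof (s : Rplus R) (w : cpath) :
  continuous (fun t => w (Rplus_add s t)).
Proof.
move=> t; apply: (@continuous_comp _ _ _ (Rplus_add s) w).
  exact: Rplus_add_continuous.
exact: cts_fun.
Qed.

Definition time_shift (s : Rplus R) (w : cpath) : cpath :=
  mkcts (@time_shift_subproof s w).

Lemma measurable_time_shift s : measurable_fun [set: cpath] (time_shift s).
Proof.
apply: measurable_continuous_cpath; apply: cpath_continuous => w K E cK entE.
have cK' : compact (Rplus_add s @` K).
  apply: continuous_compact => //; apply: continuous_subspaceT.
  exact: Rplus_add_continuous.
by apply: filterS (cpath_nbhs w cK' entE) => w' h t Kt; apply: h; exists t.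
Qed.

HB.instance Definition _ s :=
  isMeasurableFun.Build _ _ _ _ (time_shift s) (measurable_time_shift s).

Lemma translate_subproof (z : 'rV[R]_d) (w : cpath) :
  continuous (fun t => z + w t).
Proof.
move=> t; apply: (@continuousD _ _ _ (cst z) w); first exact: cst_continuous.
exact: cts_fun.
Qed.

Definition translate (z : 'rV[R]_d) (w : cpath) : cpath :=
  mkcts (@translate_subproof z w).

Lemma measurable_translate z : measurable_fun [set: cpath] (translate z).
Proof.
apply: measurable_continuous_cpath; apply: cpath_continuous => w K E cK.
rewrite -entourage_from_ballE => -[e /= e0 eE].
have entB : entourage [set xy : 'rV[R]_d * 'rV[R]_d | ball xy.1 e xy.2].
  exact: (entourage_ball _ (PosNum e0)).
apply: filterS (cpath_nbhs w cK entB) => w' h t Kt; apply: eE => /=.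
have := h t Kt; rewrite /= -!ball_normE /ball_ /=.
by rewrite opprD addrACA subrr add0r.
Qed.

HB.instance Definition _ z :=
  isMeasurableFun.Build _ _ _ _ (translate z) (measurable_translate z).

End path_space.

Section nonlinear_Markov.
Variables (R : realType) (d : nat).

(* A term of type [probability T R] is a function on all subsets of [T] and is
   unconstrained on non-measurable ones, so equality of Borel probability
   measures is equality on measurable sets, not Leibniz equality. *)
Definition same_law disp (T : measurableType disp) (mu nu : set T -> \bar R) :=
  forall A, measurable A -> mu A = nu A.

Definition marginal (P : probability (cpath R d) R) (t : Rplus R) :
  probability 'rV[R]_d R := distribution P (@eval_at R d t).

Definition canonical_filtration (s : Rplus R) : set (set (cpath R d)) :=
  <<s \bigcup_(r in [set r | set_val r <= set_val s])
        preimage_set_system setT (@eval_at R d r) measurable >>.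

(* [g] is a version of P(E | G). *)
Definition is_cond_probability disp (T : measurableType disp)
    (P : probability T R) (G : set (set T)) (E : set T) (g : T -> R) :=
  [/\ forall B : set R, measurable B -> G (g @^-1` B),
      P.-integrable setT (EFin \o g) &
      forall F, G F -> (\int[P]_(w in F) (g w)%:E = P (E `&` F))%E].

Definition is_disintegration (P : probability (cpath R d) R)
    (K : R.-pker 'rV[R]_d ~> cpath R d) :=
  same_law P (fun B => \int[marginal P (Rplus0 R)]_y K y B)%E /\
  {ae marginal P (Rplus0 R),
     forall y, K y [set w : cpath R d | w (Rplus0 R) = y] = 1%E}.

(* Membership of a law in [P0] is understood up to [same_law]: the measures
   [eta] below are the representatives in [P0] of the marginals. *)
Definition nonlinear_Markov_process (P0 : set (probability 'rV[R]_d R))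
    (P : probability 'rV[R]_d R -> probability (cpath R d) R) :=
  [/\ forall zeta, P0 zeta -> same_law (marginal (P zeta) (Rplus0 R)) zeta,
      forall zeta (t : Rplus R), P0 zeta -> 0 < set_val t ->
        exists2 eta, P0 eta & same_law (marginal (P zeta) t) eta &
      exists K : probability 'rV[R]_d R -> R.-pker 'rV[R]_d ~> cpath R d,
        (forall eta, P0 eta -> is_disintegration (P eta) (K eta)) /\
        forall (s t : Rplus R) zeta eta (A : set 'rV[R]_d),
          P0 zeta -> P0 eta -> same_law (marginal (P zeta) s) eta ->
          measurable A ->
          exists2 g : cpath R d -> R,
            is_cond_probability (P zeta) (canonical_filtration s)
              (eval_at (Rplus_add t s) @^-1` A) g &
            {ae P zeta, forall w,
               (g w)%:E = K eta (eval_at s w) (eval_at t @^-1` A)}].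

Definition nonlinear_Markov_core
    (mu : Rplus R -> 'rV[R]_d -> probability 'rV[R]_d R)
    (P : 'rV[R]_d -> probability (cpath R d) R) :=
  [/\ forall z, same_law (mu (Rplus0 R) z) (\d_z),
      forall t z t' z', same_law (mu t z) (mu t' z') -> t = t' /\ z = z',
      forall t z, same_law (marginal (P z) t) (mu t z) &
      exists Q : probability 'rV[R]_d R -> probability (cpath R d) R,
        (forall t z,
          same_law (Q (mu t z)) (distribution (P z) (@time_shift R d t))) /\
        nonlinear_Markov_process
          [set mu tz.1 tz.2 | tz in [set: Rplus R * 'rV[R]_d]] Q].

Definition nonlinear_Markov_core_density
    (u : 'rV[R]_d -> R -> 'rV[R]_d -> R)
    (P : 'rV[R]_d -> probability (cpath R d) R) :=
  exists mu : Rplus R -> 'rV[R]_d -> probability 'rV[R]_d R,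
    [/\ forall z, same_law (mu (Rplus0 R) z) (\d_z),
        forall (t : Rplus R) z, 0 < set_val t ->
          same_law (mu t z)
            (fun A => \int[lebesgue_rV R d]_(x in A) (u z (set_val t) x)%:E)%E &
        nonlinear_Markov_core mu P].

Definition heat_kernel (z : 'rV[R]_d) (t : R) (x : 'rV[R]_d) : R :=
  (2 * pi * t) `^ (- (d%:R / 2)) *
  expR (- ((\sum_(i < d) (x 0 i - z 0 i) ^+ 2) / (2 * t))).

(* The increment [W_t - W_s] has law N(0, (t - s) I_d), whose density is
   [heat_kernel 0 (t - s)]. *)
Definition standard_Brownian_motion disp (Omega : measurableType disp)
    (Pr : probability Omega R) (W : {RV Pr >-> cpath R d}) :=
  [/\ {ae Pr, forall o, eval_at (Rplus0 R) (W o) = 0},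
      forall s t : Rplus R, set_val s < set_val t ->
        same_law (fun A => Pr [set o | A (eval_at t (W o) - eval_at s (W o))])
          (fun A => \int[lebesgue_rV R d]_(x in A)
                     (heat_kernel 0 (set_val t - set_val s) x)%:E)%E &
      forall (n : nat) (t : nat -> Rplus R) (A : nat -> set 'rV[R]_d),
        (forall i, set_val (t i) <= set_val (t i.+1)) ->
        (forall i, measurable (A i)) ->
        Pr [set o | forall i, (i < n)%N ->
                      A i (eval_at (t i.+1) (W o) - eval_at (t i) (W o))] =
        (\prod_(i < n)
           Pr [set o | A i (eval_at (t i.+1) (W o) - eval_at (t i) (W o))%R])%E].

Definition started_at disp (Omega : measurableType disp)
    (Pr : probability Omega R) (W : {RV Pr >-> cpath R d}) (z : 'rV[R]_d) :
  probability (cpath R d) R := distribution Pr (translate z \o W).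

End nonlinear_Markov.

(* Main.v *)
Require Import Defs.
From HB Require Import structures.
From mathcomp Require Import all_boot all_order all_algebra.
From mathcomp Require Import all_classical all_reals all_analysis.
From mathcomp Require Import measurable_realfun.
From mathcomp Require Import ring.

Set Implicit Arguments.
Unset Strict Implicit.
Unset Printing Implicit Defensive.

Import Order.TTheory GRing.Theory Num.Theory.
Import numFieldNormedType.Exports.

Local Open Scope classical_set_scope.
Local Open Scope ring_scope.

(** Why Wiener measures form a nonlinear Markov core.

    Everything rests on one fact about the law [P] of Brownian motion on path
    space: for each time [r], the path of increments [w (r + t) - w r] is
    independent of the past up to time [r] and has again law [P]
    ([increments_from_indep], [increments_from_law]).  Since
    [w (r + t) = w r + (w (r + t) - w r)], freezing the past
    ([increments_from_freezing]) shows that, whatever the value [y] of the path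
    at time [r], the future is governed by the law of [y + W].  Hence the single
    kernel [y |-> law of y + W] ([translation_law]) disintegrates every law
    [W^z o Pi_r^-1] with respect to its initial value
    ([shifted_disintegration]) and gives the conditional probabilities demanded
    by the Markov property ([shifted_cond_probability]).  The dependence on the
    initial law that the notion of nonlinear Markov process permits is thus
    trivial here.

    The independence is first proved for finitely many times.  Given a sorted
    grid of times containing [r], the increments before and after [r] satisfy
    the product rule on boxes; boxes over one grid are stable under
    intersection, so the rule extends to the sigma-algebras that they generate,
    and these contain the cylinder events with times in the grid.  Cylinder
    events over arbitrary times are stable under intersection as well, and they
    generate the Borel sigma-algebra of path space ([measurable_cpathE]); a
    second monotone class argument concludes.  For stationarity, the same
    boxes are compared under the increments from time [r] and from time 0.

    Two points concern the one-dimensional marginals.  That [z + W_t] has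
    density [heat_kernel z t] comes from translation invariance of the Lebesgue
    measure on R^d.  That [(t, z)] can be recovered from the law of [z + W_t],
    which makes the core well defined, holds because two continuous densities
    with the same integrals coincide everywhere, and the heat kernel attains its
    maximum, a strictly decreasing function of [t] when [0 < d], at [z] only;
    time 0 is set apart as the only one whose marginals have atoms. *)

(** * Cylinder events and the Borel sigma-algebra of path space *)

Section path_neighborhoods.
Context {R : realType} {d : nat}.

Lemma max0_ge0 (x : R) : [set r : R | 0 <= r] (Num.max x 0).
Proof. by rewrite /= le_max lexx orbT. Qed.

(** Real numbers as times: a retraction of the line onto the half-line, through
    which rational numbers and the compactness of segments of the line become
    available on the half-line. *)
Definition clamp (x : R) : Rplus R :=
  SigSub (mem_set (max0_ge0 x)).

Lemma val_clamp x : set_val (clamp x) = Num.max x 0.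
Proof. by []. Qed.

Lemma clampK (t : Rplus R) : clamp (set_val t) = t.
Proof.
by apply: val_inj; rewrite /=; apply/max_idPl; exact: (set_valP t).
Qed.

Lemma clamp_continuous : continuous clamp.
Proof.
apply: continuous_comp_initial => x.
rewrite (_ : set_val \o clamp = (fun r : R => Num.max r 0))//.
apply: continuous_max; [exact: cvg_id|exact: cvg_cst].
Qed.

(** The topology of path space is an initial topology for a supremum of
    topologies, one for each compact set.  Rather than unfolding it, one checks
    that the filter generated by the tubes around [w] over bounded time
    intervals converges to [w]. *)
Lemma nbhs_cpath_ball (w : cpath R d) (U : set (cpath R d)) : nbhs w U ->
  exists N : nat, exists2 e : R, 0 < e &
    forall w' : cpath R d,
      (forall t : Rplus R, set_val t < N%:R -> ball (w t) e (w' t)) -> U w'.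
Proof.
move=> [_ [[G oG <-] Gw GU]].
pose F : set_system (Rplus R -> 'rV[R]_d) :=
  filter_from [set p : nat * R | 0 < p.2]
    (fun p => [set g | forall t : Rplus R, set_val t < p.1%:R -> ball (w t) p.2 (g t)]).
have FF : Filter F.
  apply: filter_from_filter; first by exists (0%N, 1) => /=.
  move=> [n e] [m f] /= e0 f0; exists (maxn n m, Num.min e f).
    by rewrite /= lt_min e0.
  move=> g /= h; split=> t tn.
    apply: (@le_ball _ _ _ (Num.min e f)); first by rewrite ge_min lexx.
    by apply: h; rewrite (lt_le_trans tn)// ler_nat leq_maxl.
  apply: (@le_ball _ _ _ (Num.min e f)); first by rewrite ge_min lexx orbT.
  by apply: h; rewrite (lt_le_trans tn)// ler_nat leq_maxr.
have : {family compact, F --> (w : Rplus R -> 'rV[R]_d)}.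
  apply/fam_cvgP => K cK V /uniform_nbhs[E [entE EV]].
  move: entE; rewrite -entourage_from_ballE => -[e /= e0 eE].
  have /compact_bounded[M [Mr MP]] : compact (set_val @` K : set R).
    apply: continuous_compact cK; apply: continuous_subspaceT.
    exact: initial_continuous.
  have [N NM] : exists N : nat, M + 1 < N%:R.
    exists (Num.trunc (`|M| + 1)).+1; rewrite (le_lt_trans _ (truncnS_gt _))//.
    by rewrite lerD2r ler_norm.
  exists (N, e) => //= g gw; apply: EV => t Kt; apply: eE; apply: gw.
  apply: le_lt_trans NM; apply: le_trans (ler_norm _) _.
  by apply: MP; [rewrite ltrDl|exists t].
move=> /(_ G)[|[N e] /= e0 eG]; first by apply: open_nbhs_nbhs.
exists N, e => // w' ww'; apply: GU => /=; exact: eG.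
Qed.

Lemma cpath_unif_continuous (w : cpath R d) (N : nat) (e : R) : 0 < e ->
  exists m : nat, forall s t : Rplus R, set_val s < N%:R ->
    `|set_val s - set_val t| < m.+1%:R^-1 -> ball (w s) e (w t).
Proof.
move=> e0.
pose f (x : R) := w (clamp x).
have cf : continuous f.
  by move=> x; apply: continuous_comp; [exact: clamp_continuous|exact: cts_fun].
have cK : compact (`[0, N%:R] : set R) by exact: segment_compact.
have [m _ mP] : \forall m \near \oo, `[0, N%:R] `<=`
    [set x : R | forall y, `|x - y| < m.+1%:R^-1 -> ball (f x) e (f y)].
  move: cK => /compact_near_coveringP; apply => x _.
  have /nbhs_ballP[r /= r0 rP] : nbhs x [set y | ball (f x) (e / 2) (f y)].
    by apply: (cf x); apply: nbhsx_ballx; rewrite divr_gt0.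
  have r20 : 0 < r / 2 by rewrite divr_gt0.
  exists (ball x (r / 2), [set m | m.+1%:R^-1 < r / 2]).
    split; [exact: nbhsx_ballx|exact: (near_infty_natSinv_lt (PosNum r20))].
  move=> [x' m] [/= xx' mr] y x'y.
  apply: (@ball_splitr _ _ (f x)); apply: rP.
    by apply: le_ball xx'; rewrite ler_pdivrMr// ler_peMr// ?ler1n// ltW.
  rewrite /ball /= (splitr r) -(subrK x' x) -addrA.
  by rewrite (le_lt_trans (ler_normD _ _))// ltrD// (lt_trans x'y).
exists m => s t sN st; have := mP m (leqnn m) (set_val s).
rewrite /= in_itv/= (set_valP s : 0 <= _) (ltW sN) => /(_ isT (set_val t) st).
by rewrite /f !clampK.
Qed.

End path_neighborhoods.

Section cylinders.
Context {R : realType} {d : nat}.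
Implicit Types (w : cpath R d) (D : set (Rplus R)).

Lemma ratr_row_dense (v : 'rV[R]_d) (e : R) : 0 < e ->
  exists q : 'rV[rat]_d, ball v e (map_mx ratr q).
Proof.
move=> e0.
have /choice[f fP] : forall i, exists q : rat, `|v 0 i - ratr q| < e.
  move=> i; have [|q] := @rat_in_itvoo R (v 0 i - e) (v 0 i + e).
    by rewrite ltrD2l gtrN.
  rewrite in_itv /= => /andP[h1 h2]; exists q.
  by rewrite distrC ltr_distl h1.
exists (\row_i f i); split=> // i j.
by rewrite ord1 !mxE; exact: fP.
Qed.

(** The events are indexed by one set per time, not by a list of pairs, so that
    two of them intersect by concatenating the lists of times. *)
Definition cylinders D : set (set (cpath R d)) :=
  [set C | exists ts : seq (Rplus R), exists A : Rplus R -> set 'rV[R]_d,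
    [/\ forall t, t \in ts -> D t, forall t, measurable (A t) &
        C = [set w : cpath R d | forall t, t \in ts -> A t (w t)]]].

Lemma cylinders1 D t (A : set 'rV[R]_d) : D t -> measurable A ->
  cylinders D (eval_at t @^-1` A).
Proof.
move=> Dt mA; exists [:: t], (fun=> A); split => //.
  by move=> r; rewrite inE => /eqP ->.
apply/seteqP; split=> w /= h; first by move=> r; rewrite inE => /eqP ->.
by apply: h; rewrite inE.
Qed.

Lemma cylindersT D : cylinders D setT.
Proof.
by exists [::], (fun=> setT); split => //; apply/seteqP; split.
Qed.

Lemma setI_closed_cylinders D : setI_closed (cylinders D).
Proof.
move=> _ _ [ts [A [tsD mA ->]]] [us [B [usD mB ->]]].
exists (ts ++ us), (fun t => (if t \in ts then A t else setT) `&`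
                             (if t \in us then B t else setT)); split.
- by move=> t; rewrite mem_cat => /orP[]; [exact: tsD|exact: usD].
- by move=> t; apply: measurableI; case: ifP.
- apply/seteqP; split=> w /=.
    by move=> [h1 h2] t _; split; case: ifPn => // ?; [exact: h1|exact: h2].
  by move=> h; split=> t tt; have := h t; rewrite mem_cat tt ?orbT => /(_ isT)[].
Qed.

Lemma cylinders_measurable D : cylinders D `<=` measurable.
Proof.
move=> _ [ts [A [_ mA ->]]].
rewrite (_ : [set _ | _] = \bigcap_(t in [set t | t \in ts]) (eval_at t @^-1` A t)).
  apply: fin_bigcap_measurable => [|t _]; first exact: finite_seq.
  by rewrite -[X in measurable X]setTI; exact: measurable_eval_at.
by apply/seteqP; split=> w /= h t; exact: h.
Qed.

Lemma canonical_filtrationE s :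
  @canonical_filtration R d s =
  <<s cylinders [set r : Rplus R | set_val r <= set_val s] >>.
Proof.
apply/seteqP; split.
  apply: smallest_sub; first exact: smallest_sigma_algebra.
  move=> _ [r rs [A mA <-]]; rewrite setTI; apply: sub_sigma_algebra.
  exact: cylinders1.
apply: smallest_sub; first exact: smallest_sigma_algebra.
move=> _ [ts [A [tsD mA ->]]].
rewrite (_ : [set _ | _] = \bigcap_(t in [set t | t \in ts]) (eval_at t @^-1` A t)).
  apply: (@fin_bigcap_measurable _ (g_sigma_algebraType
    (\bigcup_(r in [set r | set_val r <= set_val s])
        preimage_set_system setT (@eval_at R d r) measurable))) => [|t tts].
    exact: finite_seq.
  apply: sub_sigma_algebra; exists t => //=; first exact: tsD.
  by exists (A t) => //; rewrite setTI.
by apply/seteqP; split=> w /= h t; exact: h.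
Qed.

(** Since the values are rational, the mesh uniform and the tube only tested at
    rational times, there are countably many tubes, and each of them is a
    countable intersection of cylinder events. *)
Let step_tube (p : nat * nat * nat * seq 'rV[rat]_d) : set (cpath R d) :=
  let: (N, m, k, q) := p in
  [set w : cpath R d | forall r : rat, set_val (clamp (ratr r : R) : Rplus R) < N%:R ->
     ball (w (clamp (ratr r : R))) k.+1%:R^-1
       (map_mx ratr
         (nth 0 q (Num.trunc (set_val (clamp (ratr r : R)) * m.+1%:R))))].

(** By uniform continuity on bounded time intervals, a path lies in a thin tube
    around some rational step function, and any other path of that tube is
    uniformly close to it.  The step function at the centre need not be a path:
    countability of the family of tubes is what matters. *)
Let open_bigcup_step_tube (U : set (cpath R d)) : open U ->
  U = \bigcup_(p in [set p | step_tube p `<=` U]) step_tube p.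
Proof.
move=> oU; apply/seteqP; split=> [w Uw|w [p /= + pw]]; last exact.
have [N [e e0 eU]] := nbhs_cpath_ball (open_nbhs_nbhs (conj oU Uw)).
(* Two paths of one tube are compared through four steps: from a time to a
   nearby rational time, to the step function, and back. *)
have [k kP] : exists k : nat, k.+1%:R^-1 < e / 4.
  have [k _ /(_ k (leqnn k))] :=
    near_infty_natSinv_lt (PosNum (divr_gt0 e0 (ltr0n R 4))).
  by exists k.
set h : R := k.+1%:R^-1 in kP.
have h0 : 0 < h by rewrite invr_gt0.
have [m mP] := cpath_unif_continuous w N (divr_gt0 h0 (ltr0n R 2)).
have m0 : 0 < m.+1%:R :> R by [].
have /choice[q qP] : forall j : nat, exists q : 'rV[rat]_d,
    ball (w (clamp (j%:R / m.+1%:R))) (h / 2) (map_mx ratr q).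
  by move=> j; apply: ratr_row_dense; rewrite divr_gt0.
have ww : step_tube (N, m, k, mkseq q (N * m.+1)) w.
  move=> /= r; set s := clamp (ratr r) => sN.
  have s0 : 0 <= set_val s := set_valP s.
  have sm0 : 0 <= set_val s * m.+1%:R by rewrite mulr_ge0.
  set j := Num.trunc _.
  have /andP[j1 j2] := truncn_itv sm0; rewrite -/j in j1 j2.
  have jN : (j < N * m.+1)%N.
    by rewrite -(ltr_nat R) (le_lt_trans j1)// natrM ltr_pM2r.
  rewrite nth_mkseq//.
  apply: (@ball_split _ _ (w (clamp (j%:R / m.+1%:R)))); last exact: qP.
  apply: mP => //; rewrite val_clamp (max_idPl _) ?divr_ge0//.
  rewrite ger0_norm; last by rewrite subr_ge0 ler_pdivrMr.
  rewrite -(ltr_pM2r m0) mulrBl divfK ?gt_eqF// mulVf ?gt_eqF//.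
  by rewrite ltrBlDl natr1.
exists (N, m, k, mkseq q (N * m.+1)) => //=.
move=> w' w'q; apply: eU => t tN.
have t0 : 0 <= set_val t := set_valP t.
have near_path (v : cpath R d) : exists2 c : R, 0 < c &
    forall y, `|set_val t - y| < c -> ball (v t) h (v (clamp y)).
  have cv : {for set_val t, continuous (v \o clamp)}.
    by apply: continuous_comp; [exact: clamp_continuous|exact: cts_fun].
  have /nbhs_ballP[c /= c0 cP] : nbhs (set_val t) [set y | ball (v t) h (v (clamp y))].
    by apply: cv => /=; rewrite clampK; exact: nbhsx_ballx.
  by exists c.
have [c c0 cP] := near_path w; have [c' c'0 c'P] := near_path w'.
pose b := Num.min (N%:R - set_val t) (Num.min c c').
have b0 : 0 < b by rewrite !lt_min subr_gt0 tN c0.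
have [|r] := @rat_in_itvoo R (set_val t) (set_val t + b); first by rewrite ltrDl.
rewrite in_itv /= => /andP[tr]; rewrite -ltrBlDl !lt_min => /and3P[r1 r2 r3].
have r0 : 0 <= (ratr r : R) by rewrite (le_trans t0)// ltW.
have tr' : `|set_val t - ratr r| = ratr r - set_val t.
  by rewrite distrC gtr0_norm// subr_gt0.
have rN : set_val (clamp (ratr r : R) : Rplus R) < N%:R.
  by rewrite val_clamp (max_idPl _)// -(ltrD2r (- set_val t)).
have := w'q r rN; have := ww r rN.
set qq := nth _ _ _ => bw bw'.
apply: (@le_ball _ _ _ (h + h + (h + h))).
  rewrite (_ : h + h + (h + h) = 4 * h); last by ring.
  by rewrite mulrC -ler_pdivlMr// ltW.
have bt : ball (w t) h (w (clamp (ratr r : R))) by apply: cP; rewrite tr'.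
have bt' : ball (w' t) h (w' (clamp (ratr r : R))) by apply: c'P; rewrite tr'.
exact: ball_triangle (ball_triangle bt bw) (ball_sym (ball_triangle bt' bw')).
Qed.

Lemma measurable_cpathE : measurable = <<s cylinders [set: Rplus R] >>.
Proof.
apply/seteqP; split; last first.
  by apply: smallest_sub; [exact: sigma_algebra_measurable|exact: cylinders_measurable].
apply: smallest_sub; first exact: smallest_sigma_algebra.
pose G := g_sigma_algebraType (cylinders [set: Rplus R]).
move=> U oU; rewrite (open_bigcup_step_tube oU) bigcup_mkcond.
apply: (@countable_bigcupT_measurable _ G) => // -[[[N m] k] q].
case: ifPn => [_|_]; last exact: (@measurable0 _ G).
rewrite (_ : step_tube _ = \bigcap_(r in [set: rat])
    (if set_val (clamp (ratr r : R) : Rplus R) < N%:R then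
      eval_at (clamp (ratr r : R)) @^-1` [set v : 'rV[R]_d | ball v k.+1%:R^-1
       (map_mx ratr (nth 0 q (Num.trunc (set_val (clamp (ratr r : R)) * m.+1%:R))))]
    else setT)).
  rewrite -[X in _ X]setCK setC_bigcap; apply: (@measurableC _ G).
  apply: (@countable_bigcupT_measurable _ G) => // r; apply: (@measurableC _ G).
  case: ifPn => rN; last exact: (@measurableT _ G).
  set c : 'rV[R]_d := map_mx _ _.
  apply: sub_sigma_algebra; apply: cylinders1 => //.
  rewrite (_ : [set _ | _] = ball c k.+1%:R^-1).
    by apply: open_measurable_rV; exact: ball_open.
  by apply/seteqP; split=> v /= /ball_sym.
apply/seteqP; split=> w /= h r; first by move=> _; case: ifPn => // rN; exact: h.
by move=> rN; have := h r I; rewrite rN.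
Qed.

End cylinders.

(** * Product rules on generated sigma-algebras *)

Section product_rule.
Context {disp : measure_display} {T : measurableType disp} {R : realType}.
Variable P : probability T R.
Implicit Types (G H : set (set T)) (E F : set T).

(** Both sides are finite measures in [E]: the restriction of [P] to [F], and [P]
    scaled by [P F].  They are determined by their values on a pi-system. *)
Lemma product_rule_g_sigma G F :
  G `<=` measurable -> G setT -> setI_closed G -> measurable F ->
  (forall E, G E -> P (E `&` F) = (P E * P F)%E) ->
  forall E, <<s G >> E -> P (E `&` F) = (P E * P F)%E.
Proof.
move=> Gm GT GI mF GF E sE.
have PF0 : 0 <= fine (P F) by rewrite fine_ge0.
have fPF : P F \is a fin_num by exact: fin_num_measure.
have -> : (P E * P F = mscale (NngNum PF0) P E)%E.
  by rewrite /mscale/= fineK// muleC.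
rewrite -[LHS]/(mrestr P mF E).
apply: (@g_sigma_algebra_measure_unique _ R _ G Gm (fun=> setT)) => //.
- by rewrite bigcup_const.
- by move=> A GA; rewrite /= /mrestr GF// /mscale/= fineK// muleC.
- move=> _; rewrite /= /mrestr setTI.
  by rewrite -ge0_fin_numE.
Qed.

Lemma product_rule_g_sigma2 G H :
  G `<=` measurable -> G setT -> setI_closed G ->
  H `<=` measurable -> H setT -> setI_closed H ->
  (forall E F, G E -> H F -> P (E `&` F) = (P E * P F)%E) ->
  forall E F, <<s G >> E -> <<s H >> F -> P (E `&` F) = (P E * P F)%E.
Proof.
move=> Gm GT GI Hm HT HI GH E F sE sF.
have mF : measurable F.
  exact: (smallest_sub (@sigma_algebra_measurable _ T) Hm).
apply: (@product_rule_g_sigma G) => // {sE}E GE.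
have mE : measurable E by exact: Gm.
rewrite setIC muleC; apply: (@product_rule_g_sigma H) => // {sF mF}F HF.
by rewrite setIC muleC; exact: GH.
Qed.

End product_rule.

(** * Maps into path space and the path of increments *)

Section cpath_measurability.
Context {R : realType} {d : nat}.

Lemma cpath_law_unique (P Q : {measure set (cpath R d) -> \bar R}) :
  (P setT < +oo)%E ->
  (forall C, cylinders [set: Rplus R] C -> P C = Q C) -> same_law P Q.
Proof.
move=> Poo PQ A mA.
apply: (measure_unique (cylinders [set: Rplus R]) (fun=> setT)) => //.
- exact: measurable_cpathE.
- exact: setI_closed_cylinders.
- by move=> _; exact: cylindersT.
- by rewrite bigcup_const.
Qed.

Lemma measurable_fun_cpath disp (T : measurableType disp) (f : T -> cpath R d) :
  (forall t, measurable_fun [set: T] (fun x => f x t)) ->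
  measurable_fun [set: T] f.
Proof.
move=> mf.
apply: (measurability _ measurable_cpathE).
move=> _ [_ [ts [A [_ mA ->]]] <-]; rewrite setTI.
rewrite (_ : _ @^-1` _ =
    \bigcap_(t in [set t | t \in ts]) ((fun x => f x t) @^-1` A t)).
  apply: fin_bigcap_measurable => [|t _]; first exact: finite_seq.
  by rewrite -[X in measurable X]setTI; exact: mf.
by apply/seteqP; split=> w /= h t; exact: h.
Qed.

Lemma measurable_funD_rV disp (T : measurableType disp) (f g : T -> 'rV[R]_d) :
  measurable_fun [set: T] f -> measurable_fun [set: T] g ->
  measurable_fun [set: T] (fun x => f x + g x).
Proof.
move=> mf mg; apply: measurable_fun_rV => i.
rewrite (_ : (fun _ => _) = (fun x => f x 0 i) \+ (fun x => g x 0 i)).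
  by apply: measurable_funD;
    apply: (measurableT_comp (measurable_coord_rV i)).
by apply/funext => x; rewrite /= mxE.
Qed.

Lemma measurable_funN_rV disp (T : measurableType disp) (f : T -> 'rV[R]_d) :
  measurable_fun [set: T] f -> measurable_fun [set: T] (fun x => - f x).
Proof.
move=> mf; apply: measurable_fun_rV => i.
rewrite (_ : (fun _ => _) = \- (fun x => f x 0 i)).
  by apply: measurable_funN; apply: (measurableT_comp (measurable_coord_rV i)).
by apply/funext => x; rewrite /= mxE.
Qed.

Lemma measurable_funB_rV disp (T : measurableType disp) (f g : T -> 'rV[R]_d) :
  measurable_fun [set: T] f -> measurable_fun [set: T] g ->
  measurable_fun [set: T] (fun x => f x - g x).
Proof.
by move=> mf mg; apply: measurable_funD_rV => //; exact: measurable_funN_rV.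
Qed.

(** A shift in time followed by a translation: both preserve continuity. *)
Definition increments_from (r : Rplus R) (w : cpath R d) : cpath R d :=
  translate (- w r) (time_shift r w).

Lemma increments_fromE r w t :
  increments_from r w t = w (Rplus_add r t) - w r.
Proof. exact: addrC. Qed.

Lemma measurable_increments_from r :
  measurable_fun [set: cpath R d] (increments_from r).
Proof.
apply: measurable_fun_cpath => t.
under eq_fun do rewrite increments_fromE.
by apply: measurable_funB_rV; exact: measurable_eval_at.
Qed.

HB.instance Definition _ r :=
  isMeasurableFun.Build _ _ _ _ (increments_from r) (measurable_increments_from r).

Lemma Rplus_add0r (t : Rplus R) : Rplus_add (Rplus0 R) t = t.
Proof. by apply: val_inj; exact: add0r. Qed.

Lemma Rplus_addr0 (t : Rplus R) : Rplus_add t (Rplus0 R) = t.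
Proof. by apply: val_inj; exact: addr0. Qed.

Lemma Rplus_addA (r s t : Rplus R) :
  Rplus_add r (Rplus_add s t) = Rplus_add (Rplus_add r s) t.
Proof. by apply: val_inj; exact: addrA. Qed.

Lemma Rplus_addC (s t : Rplus R) : Rplus_add s t = Rplus_add t s.
Proof. by apply: val_inj; exact: addrC. Qed.

End cpath_measurability.

(** * Increments over a grid of times *)

Section grid.
Context {R : realType} {d : nat}.
Implicit Types (tau : nat -> Rplus R) (w : cpath R d).

(** For a fixed grid these events form a pi-system; over all grids they do not. *)
Definition increment_boxes tau (a b : nat) : set (set (cpath R d)) :=
  [set C | exists2 A : nat -> set 'rV[R]_d, forall i, measurable (A i) &
     C = [set w | forall i, (a <= i < b)%N ->
            A i (eval_at (tau i.+1) w - eval_at (tau i) w)]].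

Lemma increment_boxesT tau a b : increment_boxes tau a b setT.
Proof. by exists (fun=> setT) => //; apply/seteqP; split. Qed.

Lemma increment_boxes1 tau a b j (A : set 'rV[R]_d) : (a <= j < b)%N ->
  measurable A -> increment_boxes tau a b
    ((fun w => eval_at (tau j.+1) w - eval_at (tau j) w) @^-1` A).
Proof.
move=> jab mA; exists (fun i => if i == j then A else setT).
  by move=> i; case: ifP.
apply/seteqP; split=> w /= h; first by move=> i _; case: eqP => // ->.
by have := h j jab; rewrite eqxx.
Qed.

Lemma setI_closed_increment_boxes tau a b :
  setI_closed (increment_boxes tau a b).
Proof.
move=> _ _ [A mA ->] [B mB ->]; exists (fun i => A i `&` B i).
  by move=> i; exact: measurableI.
apply/seteqP; split=> w /=; first by move=> [h1 h2] i ab; split; [exact: h1|exact: h2].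
by move=> h; split=> i ab; have [] := h i ab.
Qed.

Lemma measurable_increment (s t : Rplus R) :
  measurable_fun setT (fun w => eval_at t w - eval_at s w : 'rV[R]_d).
Proof. by apply: measurable_funB_rV; exact: measurable_eval_at. Qed.

Lemma increment_boxes_measurable tau a b : increment_boxes tau a b `<=` measurable.
Proof.
move=> _ [A mA ->].
rewrite (_ : [set _ | _] = \bigcap_(i in [set i | (a <= i < b)%N])
   ((fun w => eval_at (tau i.+1) w - eval_at (tau i) w) @^-1` A i)).
  apply: fin_bigcap_measurable => [|i _].
    by apply: (sub_finite_set _ (finite_II b)) => i /= /andP[].
  by rewrite -[X in measurable X]setTI; exact: measurable_increment.
by apply/seteqP; split=> w /= h t; exact: h.
Qed.

(** The difference telescopes into increments of the grid. *)
Lemma measurable_fun_increment_boxes tau a b j : (a <= j <= b)%N ->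
  measurable_fun [set: g_sigma_algebraType (increment_boxes tau a b)]
    (fun w => eval_at (tau j) w - eval_at (tau a) w).
Proof.
elim: j => [|j IH] /andP[aj jb].
  move: aj; rewrite leqn0 => /eqP ->.
  by under eq_fun do rewrite subrr; exact: measurable_cst.
move: aj; rewrite leq_eqVlt => /orP[/eqP <-|aj].
  by under eq_fun do rewrite subrr; exact: measurable_cst.
rewrite (_ : (fun _ => _) = (fun w =>
    (eval_at (tau j.+1) w - eval_at (tau j) w) +
    (eval_at (tau j) w - eval_at (tau a) w))); last first.
  by apply/funext => w; rewrite addrA subrK.
apply: measurable_funD_rV; last by apply: IH; rewrite -ltnS aj ltnW.
move=> _ A mA; rewrite setTI; apply: sub_sigma_algebra.
by apply: increment_boxes1 => //; rewrite -ltnS aj.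
Qed.

(** This passes from increments, where the product rule holds, to positions,
    where events over different grids can be intersected. *)
Lemma preimage_increments_from_cylinder tau a b (ts : seq (Rplus R))
    (A : Rplus R -> set 'rV[R]_d) :
  (forall t, measurable (A t)) ->
  (forall t, t \in ts -> exists2 j, (a <= j <= b)%N &
     tau j = Rplus_add (tau a) t) ->
  <<s increment_boxes tau a b >>
    (increments_from (tau a) @^-1`
       [set w : cpath R d | forall t, t \in ts -> A t (w t)]).
Proof.
move=> mA tsj.
rewrite (_ : _ @^-1` _ = \bigcap_(t in [set t | t \in ts])
    [set w | A t (eval_at (Rplus_add (tau a) t) w - eval_at (tau a) w)]).
  apply: (@fin_bigcap_measurable _ (g_sigma_algebraType (increment_boxes tau a b))).
    exact: finite_seq.
  move=> t /tsj[j jab <-].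
  have := measurable_fun_increment_boxes (tau := tau) jab.
  by move=> /(_ measurableT _ (mA t)); rewrite setTI.
apply/seteqP; split=> w /= h t tts.
  by have := h t tts; rewrite increments_fromE.
by rewrite increments_fromE; exact: h.
Qed.

End grid.

Section time_grid.
Context {R : realType}.
Implicit Types (x t : Rplus R) (s : seq (Rplus R)).

Definition Rplus_le : rel (Rplus R) := fun r t => set_val r <= set_val t.

Lemma Rplus_le_trans : transitive Rplus_le.
Proof. by move=> t s u; exact: le_trans. Qed.

Lemma Rplus_le_total : total Rplus_le.
Proof. by move=> s t; exact: le_total. Qed.

(** The list is prolonged by its last element, so that a sorted list gives a
    nondecreasing sequence with infinitely many terms. *)
Definition time_grid x s (i : nat) : Rplus R := nth (last x s) (x :: s) i.

Lemma time_grid_le x s : path Rplus_le x s ->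
  forall i, set_val (time_grid x s i) <= set_val (time_grid x s i.+1).
Proof.
move=> /(pathP (last x s)) h i; rewrite /time_grid.
have [/h//|] := ltnP i (size s).
rewrite leq_eqVlt => /orP[/eqP <-|si].
  by rewrite -last_nth nth_default.
by rewrite !nth_default//= ltnW.
Qed.

Lemma time_grid_mem x s t : t \in x :: s ->
  exists2 j, (j <= size s)%N & time_grid x s j = t.
Proof.
move=> ts; exists (index t (x :: s)).
  by rewrite -ltnS -[(size s).+1]/(size (x :: s)) index_mem.
by rewrite /time_grid nth_index.
Qed.

End time_grid.

(** * Independence and stationarity of the increments *)

Lemma measurable_set1_rV (R : realType) d (v : 'rV[R]_d) : measurable [set v].
Proof.
rewrite (_ : [set v] = \bigcap_(i in [set: 'I_d])
    ((fun u : 'rV[R]_d => u 0 i) @^-1` [set v 0 i])).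
  apply: fin_bigcap_measurable => // i _.
  rewrite -[X in measurable X]setTI.
  by apply: measurable_coord_rV => //; exact: measurable_set1.
apply/seteqP; split=> [u -> //|u h].
by apply/rowP => i; exact: h.
Qed.

Lemma measure_eq_mod_null disp (T : measurableType disp) (R : realType)
    (m : {measure set T -> \bar R}) (N A B : set T) :
  measurable N -> m (~` N) = 0%E -> measurable A -> measurable B ->
  A `&` N = B `&` N -> m A = m B.
Proof.
move=> mN N0 mA mB AB.
suff mD E : measurable E -> m E = m (E `&` N) by rewrite mD// AB -mD.
move=> mE; rewrite [LHS](measureDI m mE mN) [X in (X + _)%E](_ : _ = 0%E) ?add0e//.
apply: subset_measure0 N0 => //; first exact: measurableD.
  exact: measurableC.
Qed.

Section Brownian_law.
Context {R : realType} {d : nat}.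

Definition canonical_process (w : cpath R d) : cpath R d := w.

HB.instance Definition _ := isMeasurableFun.Build _ _ _ _ canonical_process
  (@measurable_id _ (cpath R d) setT).

(** The property of being the law of a Brownian motion, phrased through the
    coordinate process so that all computations take place on path space. *)
Definition Brownian_law (P : probability (cpath R d) R) :=
  standard_Brownian_motion (canonical_process : {RV P >-> cpath R d}).

Lemma measurable_start (z : 'rV[R]_d) :
  measurable [set w : cpath R d | w (Rplus0 R) = z].
Proof.
rewrite -[X in measurable X]setTI.
exact: (measurable_eval_at (Rplus0 R) measurableT (measurable_set1_rV z)).
Qed.

Lemma Brownian_law_distribution disp (Omega : measurableType disp)
    (Pr : probability Omega R) (W : {RV Pr >-> cpath R d}) :
  standard_Brownian_motion W -> Brownian_law (distribution Pr W).
Proof.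
move=> [W0 W1 W2]; split => //.
have [N [mN N0 WN]] := W0.
exists (~` [set w : cpath R d | w (Rplus0 R) = 0]); split => //.
- by apply: measurableC; exact: measurable_start.
- rewrite /= /distribution /pushforward.
  apply: subset_measure0 N0 => //.
  rewrite -[X in measurable X]setTI; apply: (measurable_funP W) => //.
  by apply: measurableC; exact: measurable_start.
Qed.

Variable P : probability (cpath R d) R.
Hypothesis BM : Brownian_law P.

Lemma Brownian_start_null : P (~` [set w : cpath R d | w (Rplus0 R) = 0]) = 0%E.
Proof.
case: BM => -[N [mN N0 WN]] _ _.
apply: subset_measure0 N0 => //.
by apply: measurableC; exact: measurable_start.
Qed.

Lemma increments_from0 (w : cpath R d) : w (Rplus0 R) = 0 ->
  increments_from (Rplus0 R) w = w.
Proof.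
move=> w0; apply/continuousEP => t.
by rewrite increments_fromE Rplus_add0r w0 subr0.
Qed.

(** The path of increments from time 0 is the path itself, up to the null event
    that the path does not start at 0. *)
Lemma Brownian_increments_from0 (F E : set (cpath R d)) :
  measurable F -> measurable E ->
  P ((increments_from (Rplus0 R) @^-1` F) `&` E) = P (F `&` E).
Proof.
move=> mF mE.
apply: (measure_eq_mod_null (measurable_start 0) Brownian_start_null).
- apply: measurableI => //; rewrite -[X in measurable X]setTI.
  exact: measurable_increments_from.
- exact: measurableI.
- apply/seteqP; split=> w /= [[Fw Ew] w0]; split => //; split => //.
    by move: Fw; rewrite increments_from0.
  by rewrite increments_from0.
Qed.

Lemma increment_box_prob tau n (A : nat -> set 'rV[R]_d) :
  (forall i, set_val (tau i) <= set_val (tau i.+1)) ->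
  (forall i, measurable (A i)) ->
  P [set w | forall i, (i < n)%N -> A i (eval_at (tau i.+1) w - eval_at (tau i) w)] =
  (\prod_(i < n) P [set w | A i (eval_at (tau i.+1) w - eval_at (tau i) w)%R])%E.
Proof. by move=> tau_le mA; case: BM => _ _; exact. Qed.

(** Padding both boxes with trivial constraints makes them, and their
    intersection, boxes over the same [n] increments; the product formula is then
    compared factor by factor. *)
Lemma increment_boxes_product_rule tau k n (E F : set (cpath R d)) : (k <= n)%N ->
  (forall i, set_val (tau i) <= set_val (tau i.+1)) ->
  increment_boxes tau 0 k E -> increment_boxes tau k n F ->
  P (E `&` F) = (P E * P F)%E.
Proof.
move=> kn tau_le [A mA ->] [B mB ->].
pose A' i := if (i < k)%N then A i else setT.
pose B' i := if (i < k)%N then setT else B i.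
rewrite (_ : [set w | forall i, (0 <= i < k)%N -> _] =
  [set w | forall i, (i < n)%N ->
     A' i (eval_at (tau i.+1) w - eval_at (tau i) w)]); last first.
  apply/seteqP; split=> w /= h i.
    by move=> _; rewrite /A'; case: ifPn => // ik; exact: h.
  by move=> /= ik; have := h i (leq_trans ik kn); rewrite /A' ik.
rewrite (_ : [set w | forall i, (k <= i < n)%N -> _] =
  [set w | forall i, (i < n)%N ->
     B' i (eval_at (tau i.+1) w - eval_at (tau i) w)]); last first.
  apply/seteqP; split=> w /= h i.
    by move=> ni; rewrite /B'; case: ltnP => // ik; apply: h; rewrite ik.
  by move=> /andP[ki ni]; have := h i ni; rewrite /B' ltnNge ki.
rewrite (_ : _ `&` _ = [set w | forall i, (i < n)%N ->
    (A' i `&` B' i) (eval_at (tau i.+1) w - eval_at (tau i) w)]); last first.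
  apply/seteqP; split=> w /=.
    by move=> [h1 h2] i ni; split; [exact: h1|exact: h2].
  by move=> h; split=> i ni; case: (h i ni).
have mA' i : measurable (A' i) by rewrite /A'; case: ifP.
have mB' i : measurable (B' i) by rewrite /B'; case: ifP.
rewrite (@increment_box_prob _ _ (fun i => A' i `&` B' i))//; last first.
  by move=> i; exact: measurableI.
rewrite !increment_box_prob//.
rewrite -big_split /=; apply: eq_bigr => i _.
rewrite /A' /B'; case: ifPn => ik.
  rewrite [X in (_ * P X)%E](_ : _ = setT) ?probability_setT ?mule1//.
  by congr (P _); apply/seteqP; split=> w //= [].
rewrite [X in (P X * _)%E](_ : _ = setT) ?probability_setT ?mul1e//.
by congr (P _); apply/seteqP; split=> w //= [].
Qed.

(** For [s < t] both laws have the density attached to [t - s]; for [s = t] both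
    increments vanish, and there is no density. *)
Lemma increment_stationary (r s t : Rplus R) (A : set 'rV[R]_d) :
  set_val s <= set_val t -> measurable A ->
  P [set w | A (eval_at (Rplus_add r t) w - eval_at (Rplus_add r s) w)] =
  P [set w | A (eval_at t w - eval_at s w)].
Proof.
rewrite le_eqVlt => /orP[/eqP/val_inj ->|st] mA.
  by congr (P _); apply/seteqP; split=> w /=; rewrite !subrr.
case: BM => _ h _.
apply: (etrans (h _ (Rplus_add r t) _ A mA)); first by rewrite /= ltrD2l.
apply: esym; apply: (etrans (h _ t st A mA)).
by rewrite /= opprD addrACA subrr add0r.
Qed.

(** On the boxes over a grid that contains the times of a cylinder event, the
    increments from [r] and those from 0 have the same law by the product formula
    and stationarity.  A cylinder event only belongs to the sigma-algebra of the
    boxes after its path has been recentered at its starting point, whence the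
    detour through the increments from time 0 of the increments from [r]. *)
Lemma increments_from_law r : same_law (distribution P (increments_from r)) P.
Proof.
apply: cpath_law_unique; first exact: fin_num_fun_lty.
move=> _ [us [B [_ mB ->]]].
set C := [set w : cpath R d | _].
have mC : measurable C by apply: (@cylinders_measurable _ _ setT); exists us, B; split.
pose s := sort (@Rplus_le R) us.
pose tau := time_grid (Rplus0 R) s.
have tau_le : forall i, set_val (tau i) <= set_val (tau i.+1).
  apply: time_grid_le.
  rewrite (path_sortedE (@Rplus_le_trans R)) (sort_sorted (@Rplus_le_total R)) andbT.
  by apply/allP => t _; exact: (set_valP t).
have tau0 : tau 0%N = Rplus0 R by [].
have sC : <<s increment_boxes tau 0 (size s) >> (increments_from (Rplus0 R) @^-1` C).
  rewrite -tau0; apply: preimage_increments_from_cylinder => // t tus.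
  have [|j js <-] := @time_grid_mem _ (Rplus0 R) s t.
    by rewrite inE mem_sort tus orbT.
  by exists j => //; rewrite tau0 Rplus_add0r.
transitivity (distribution P (increments_from (Rplus0 R)) C); last first.
  rewrite -[LHS]/(P (increments_from (Rplus0 R) @^-1` C)).
  by have := Brownian_increments_from0 mC measurableT; rewrite !setIT.
transitivity (distribution P (increments_from r) (increments_from (Rplus0 R) @^-1` C)).
  congr (P _); apply/seteqP; split=> w /= h t /h;
    by rewrite !increments_fromE Rplus_add0r Rplus_addr0 subrr subr0.
transitivity (distribution P (increments_from (Rplus0 R))
  (increments_from (Rplus0 R) @^-1` C)); last first.
  congr (P _); apply/seteqP; split=> w /= h t /h;
    by rewrite !increments_fromE !Rplus_add0r subrr subr0.
have bm := @increment_boxes_measurable R d tau 0 (size s).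
apply: (@g_sigma_algebra_measure_unique _ R _ _ bm (fun=> setT)) => //.
- by move=> _; exact: increment_boxesT.
- by rewrite bigcup_const.
- exact: setI_closed_increment_boxes.
- move=> _ [A mA ->].
  have shift q : distribution P (increments_from q)
      [set w | forall i, (0 <= i < size s)%N ->
         A i (eval_at (tau i.+1) w - eval_at (tau i) w)] =
    (\prod_(i < size s) P [set w | A i (eval_at (tau i.+1) w - eval_at (tau i) w)%R])%E.
    under [RHS]eq_bigr do rewrite -(increment_stationary q (tau_le _) (mA _)).
    rewrite -(@increment_box_prob (fun i => Rplus_add q (tau i)))//; last first.
      by move=> i; rewrite lerD2l.
    congr (P _); apply/seteqP; split=> w /= h i si.
      by have := h i si; rewrite /eval_at !increments_fromE opprB addrA subrK.
    by rewrite /eval_at !increments_fromE opprB addrA subrK; exact: h.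
  exact: (etrans (shift r) (esym (shift (Rplus0 R)))).
- by move=> _; exact: fin_num_fun_lty.
Qed.

(** The grid consists of 0, the times of [F] in increasing order, then [r], then
    the times of [B] shifted by [r] in increasing order.  Up to a null set, [F]
    depends on the increments before [r], and the other event on those after. *)
Lemma cylinder_increments_from_indep r (F B : set (cpath R d)) :
  cylinders [set t | set_val t <= set_val r] F ->
  cylinders [set: Rplus R] B ->
  P (F `&` increments_from r @^-1` B) = (P F * P (increments_from r @^-1` B))%E.
Proof.
move=> cF cB.
have mF := cylinders_measurable cF; have mB := cylinders_measurable cB.
have mrB : measurable (increments_from r @^-1` B).
  by rewrite -[X in measurable X]setTI; exact: measurable_increments_from.
rewrite -(Brownian_increments_from0 mF mrB).
have := Brownian_increments_from0 mF measurableT; rewrite !setIT => <-.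
case: cF mF => ts [A [tsr mA ->]] _; case: cB mB mrB => us [B' [_ mB' ->]] _ _.
pose s1 := sort (@Rplus_le R) ts.
pose s2 := sort (@Rplus_le R) (map (Rplus_add r) us).
pose s := s1 ++ r :: s2.
pose tau := time_grid (Rplus0 R) s.
(* The position of [r] in the grid. *)
pose k := (size s1).+1.
have s1r t : t \in Rplus0 R :: s1 -> Rplus_le t r.
  by rewrite inE mem_sort => /orP[/eqP ->|/tsr//]; exact: (set_valP r).
have tau_le : forall i, set_val (tau i) <= set_val (tau i.+1).
  apply: time_grid_le; rewrite /s cat_path/= !(path_sortedE (@Rplus_le_trans R)).
  rewrite !(sort_sorted (@Rplus_le_total R)) !andbT; apply/and3P; split.
  - by apply/allP => t _; exact: (set_valP t).
  - by apply: s1r; exact: mem_last.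
  - apply/allP => t; rewrite mem_sort => /mapP[u _ ->].
    by rewrite /Rplus_le /= lerDl; exact: (set_valP u).
have tau0 : tau 0%N = Rplus0 R by [].
have tauk : tau k = r by rewrite /tau /time_grid /= nth_cat ltnn subnn.
have kn : (k <= size s)%N by rewrite /s size_cat /= addnS ltnS leq_addr.
apply: (product_rule_g_sigma2 (@increment_boxes_measurable _ _ tau 0 k)
  (increment_boxesT tau 0 k) (@setI_closed_increment_boxes _ _ tau 0 k)
  (@increment_boxes_measurable _ _ tau k (size s))
  (increment_boxesT tau k (size s))
  (@setI_closed_increment_boxes _ _ tau k (size s))).
- by move=> E G; exact: increment_boxes_product_rule.
- rewrite -tau0; apply: preimage_increments_from_cylinder => // t tts.
  have /(nthP (Rplus0 R))[j js <-] : t \in Rplus0 R :: s1.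
    by rewrite inE mem_sort tts orbT.
  exists j; first exact: ltnW.
  rewrite tau0 Rplus_add0r /tau /time_grid.
  rewrite -cat_cons nth_cat js.
  exact: set_nth_default.
- rewrite -[in increments_from _]tauk.
  apply: preimage_increments_from_cylinder => // t tus.
  have /(nthP (Rplus0 R))[j js jE] : Rplus_add r t \in s2.
    by rewrite mem_sort map_f.
  exists (k.+1 + j)%N.
    have -> : size s = (k + size s2)%N by rewrite /s size_cat /= addnS.
    by rewrite addSnnS leq_addr leq_add2l.
  rewrite tauk -jE /tau /time_grid /s /=.
  rewrite /k addSn nth_cat ltnNge leqW ?leq_addr//= subSn ?leq_addr//= addKn.
  exact: set_nth_default.
Qed.

End Brownian_law.

(** * The Markov property of the Wiener measures *)

Section Markov.
Context {R : realType} {d : nat}.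
Variable P : probability (cpath R d) R.
Hypothesis BM : Brownian_law P.

(** Path space with the sigma-algebra of the events before [r], so that joint
    measurability in the past and in the future increments is measurability on a
    product space. *)
Definition past (r : Rplus R) := g_sigma_algebraType
  (\bigcup_(u in [set u | set_val u <= set_val r])
     preimage_set_system setT (@eval_at R d u) measurable).

Lemma measurable_eval_at_past (r u : Rplus R) : set_val u <= set_val r ->
  measurable_fun [set: past r] (@eval_at R d u : past r -> 'rV[R]_d).
Proof.
move=> ur _ A mA; apply: sub_sigma_algebra; exists u => //=.
by exists A.
Qed.

Lemma past_measurable r :
  @measurable _ (past r) `<=` (measurable : set (set (cpath R d))).
Proof.
apply: smallest_sub; first exact: sigma_algebra_measurable.
move=> _ [u _ [A mA <-]]; rewrite setTI -[X in measurable X]setTI.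
exact: measurable_eval_at.
Qed.

Lemma increments_from_indep r (F B : set (cpath R d)) :
  canonical_filtration r F -> measurable B ->
  P (F `&` increments_from r @^-1` B) = (P F * P B)%E.
Proof.
rewrite canonical_filtrationE => cF mB.
rewrite -[P B](increments_from_law BM r)//.
pose H := preimage_set_system setT (@increments_from R d r) (cylinders [set: Rplus R]).
have sB : <<s H >> (increments_from r @^-1` B).
  rewrite /H g_sigma_preimageE; exists B; last by rewrite setTI.
  rewrite -[X in X B]/(<<s cylinders [set: Rplus R] >>).
  by rewrite -measurable_cpathE.
have HE C : H C ->
    exists2 B, cylinders [set: Rplus R] B & C = increments_from r @^-1` B.
  by move=> [C' cC' <-]; exists C' => //; rewrite setTI.
apply: product_rule_g_sigma2 cF sB.
- exact: cylinders_measurable.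
- exact: cylindersT.
- exact: setI_closed_cylinders.
- move=> _ /HE[C cC ->]; rewrite -[X in measurable X]setTI.
  by apply: measurable_increments_from => //; exact: cylinders_measurable cC.
- by exists setT; [exact: cylindersT|rewrite preimage_setT setTI].
- move=> _ _ /HE[C cC ->] /HE[C' cC' ->]; rewrite -preimage_setI.
  exists (C `&` C'); last by rewrite setTI.
  exact: setI_closed_cylinders.
- by move=> E _ cE /HE[C cC ->]; exact: cylinder_increments_from_indep.
Qed.

Lemma measurable_id_past r : measurable_fun [set: cpath R d] (id : cpath R d -> past r).
Proof. by move=> _ A mA; rewrite setTI; exact: (past_measurable mA). Qed.

(** The pair made of the past up to [r] and of the increments from [r] has a
    product law, so that the probability of an event about the pair is obtained by
    integrating over the past with the past held fixed. *)
Lemma increments_from_freezing r (D : set (past r * cpath R d)) : measurable D ->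
  P [set w | D (w, increments_from r w)] = (\int[P]_w P (xsection D w))%E.
Proof.
move=> mD.
pose idr : {mfun cpath R d >-> past r} :=
  HB.pack (id : cpath R d -> past r)
    (isMeasurableFun.Build _ _ _ _ _ (@measurable_id_past r)).
have mj : measurable_fun [set: cpath R d] (fun w => (w : past r, increments_from r w)).
  apply/measurable_fun_pairP; split; first exact: measurable_id_past.
  exact: measurable_increments_from.
pose j : {mfun cpath R d >-> (past r * cpath R d)%type} :=
  HB.pack (fun w => (w : past r, increments_from r w))
    (isMeasurableFun.Build _ _ _ _ _ mj).
rewrite -[LHS]/(distribution P j D).
rewrite -(@product_measure_unique _ _ _ _ _ (distribution P idr) P)//; last first.
  by move=> A B mA mB; exact: increments_from_indep.
rewrite /product_measure1 ge0_integral_distribution//.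
exact: measurable_fun_xsection.
Qed.

(** The law of [y + W] when [P] is that of [W]. *)
Definition translation_law (y : 'rV[R]_d) : {measure set (cpath R d) -> \bar R} :=
  distribution P (translate y).

(** Coordinates decide measurability here, which avoids comparing the Borel
    sigma-algebra of a product with the product of the Borel sigma-algebras. *)
Lemma measurable_translate_pair disp (T : measurableType disp)
    (f : T -> 'rV[R]_d) (g : T -> cpath R d) :
  measurable_fun [set: T] f -> measurable_fun [set: T] g ->
  measurable_fun [set: T] (fun x => translate (f x) (g x)).
Proof.
move=> mf mg; apply: measurable_fun_cpath => t.
apply: measurable_funD_rV => //.
exact: (measurableT_comp (measurable_eval_at t)).
Qed.

Lemma measurable_translation_law B : measurable B ->
  measurable_fun [set: 'rV[R]_d] (translation_law ^~ B).
Proof.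
move=> mB.
have mp : measurable_fun [set: 'rV[R]_d * cpath R d] (fun p => translate p.1 p.2).
  by apply: measurable_translate_pair; [exact: measurable_fst|exact: measurable_snd].
have mD := mp measurableT _ mB; rewrite setTI in mD.
rewrite [X in measurable_fun _ X](_ : _ =
  P \o xsection ((fun p => translate p.1 p.2) @^-1` B)).
  exact: measurable_fun_xsection.
apply/funext => y; rewrite /= /translation_law /distribution /pushforward.
by congr (P _); apply/seteqP; split=> v /=; rewrite /xsection/= inE.
Qed.

HB.instance Definition _ := isKernel.Build _ _ _ _ R
  translation_law measurable_translation_law.

Lemma translation_law_setT y : translation_law y setT = 1%E.
Proof. exact: probability_setT. Qed.

HB.instance Definition _ := Kernel_isProbability.Build _ _ _ _ R
  translation_law translation_law_setT.

(** Under the law of [W], this has law [W^z o Pi_r^-1]. *)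
Definition shifted_path (z : 'rV[R]_d) r (w : cpath R d) :=
  time_shift r (translate z w).

Lemma measurable_shifted_path z r : measurable_fun setT (shifted_path z r).
Proof.
apply: measurableT_comp; [exact: measurable_time_shift|exact: measurable_translate].
Qed.

HB.instance Definition _ z r := isMeasurableFun.Build _ _ _ _
  (shifted_path z r) (@measurable_shifted_path z r).

Lemma shifted_pathE z r w :
  shifted_path z r w = translate (z + w r) (increments_from r w).
Proof.
apply/continuousEP => t; rewrite /shifted_path.
rewrite -[LHS]/(z + w (Rplus_add r t)).
by rewrite -[RHS]/(z + w r + increments_from r w t) increments_fromE -addrA
  [X in _ = z + X]addrC subrK.
Qed.

(* Laws are only constrained on measurable sets; the results are therefore stated
   for any representative [Q] of the law of the shifted path. *)
Section shifted_law.
Variables (z : 'rV[R]_d) (r : Rplus R) (Q : probability (cpath R d) R).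
Hypothesis QE : same_law Q (distribution P (shifted_path z r)).

Lemma ge0_integral_shifted (f : cpath R d -> \bar R) F : measurable F ->
  measurable_fun [set: cpath R d] f -> (forall w, 0 <= f w)%E ->
  (\int[Q]_(w in F) f w =
   \int[P]_(w in shifted_path z r @^-1` F) f (shifted_path z r w))%E.
Proof.
move=> mF mf f0.
rewrite (@eq_measure_integral _ _ _ _ (distribution P (shifted_path z r))).
  rewrite ge0_integral_pushforward//; exact: measurable_funS mf.
by move=> A mA _; exact: QE.
Qed.

(** Seen from time [r], the path is its position at [r] plus independent
    increments of law [P]. *)
Lemma shifted_disintegration : is_disintegration Q translation_law.
Proof.
split; last first.
  apply: aeW => y; rewrite /= /translation_law /distribution /pushforward.
  rewrite -(@probability_setT _ _ _ P).
  apply: (measure_eq_mod_null (measurable_start 0) (Brownian_start_null BM)) => //.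
    rewrite -[X in measurable X]setTI; apply: measurable_translate => //.
    exact: measurable_start.
  apply/seteqP; split=> w /= [_ w0]; split => //.
  by rewrite -[LHS]/(y + w (Rplus0 R)) w0 addr0.
move=> B mB; rewrite QE//.
pose D : set (past r * cpath R d) :=
  (fun p => translate (z + eval_at r p.1) p.2) @^-1` B.
have mD : measurable D.
  rewrite -[X in measurable X]setTI; apply: measurable_translate_pair => //.
  apply: measurable_funD_rV; first exact: measurable_cst.
  by apply: (measurableT_comp (measurable_eval_at_past (lexx _)));
    exact: measurable_fst.
rewrite (_ : distribution _ _ _ = P [set w | D (w, increments_from r w)]); last first.
  rewrite /distribution /pushforward; congr (P _).
  by apply/seteqP; split=> w; rewrite /D /= shifted_pathE.
rewrite increments_from_freezing//.
rewrite ge0_integral_distribution//; last exact: measurable_kernel.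
rewrite ge0_integral_shifted//; last first.
  exact: (measurableT_comp (measurable_kernel translation_law _ mB)
    (measurable_eval_at _)).
rewrite preimage_setT; apply: eq_integral => w _.
have start : eval_at (Rplus0 R) (shifted_path z r w) = z + eval_at r w.
  by rewrite -[LHS]/(z + w (Rplus_add r (Rplus0 R))) Rplus_addr0.
rewrite -[RHS]/(P (translate (eval_at (Rplus0 R) (shifted_path z r w)) @^-1` B)).
rewrite start; congr (P _).
by apply/seteqP; split=> v /=; rewrite /xsection/= inE.
Qed.

Lemma shifted_path_past s :
  measurable_fun [set: past (Rplus_add r s)]
    (shifted_path z r : past (Rplus_add r s) -> past s).
Proof.
apply: (@measurability _ _ _ _ setT
  (shifted_path z r : past (Rplus_add r s) -> past s) _ erefl).
move=> _ [_ [u us [A mA <-]] <-]; rewrite !setTI.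
rewrite (_ : shifted_path z r @^-1` _ =
  (fun w => z + eval_at (Rplus_add r u) w) @^-1` A)//.
rewrite -[X in measurable X]setTI.
apply: (@measurable_funD_rV _ _ _ (past (Rplus_add r s))) => //.
have ru : set_val (Rplus_add r u) <= set_val (Rplus_add r s) by rewrite /= lerD2l.
exact: (measurable_eval_at_past ru).
Qed.

(** An event before [s] for the shifted path is an event before [r + s] for the
    original one, and the position at time [r + s + t] is that at time [r + s]
    plus the increment, independent of the past, over the next [t] units of
    time. *)
Lemma shifted_cond_probability s t (A : set 'rV[R]_d) : measurable A ->
  is_cond_probability Q (canonical_filtration s) (eval_at (Rplus_add t s) @^-1` A)
    (fun w => fine (translation_law (eval_at s w) (eval_at t @^-1` A))).
Proof.
move=> mA.
have mtA : measurable (eval_at t @^-1` A : set (cpath R d)).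
  by rewrite -[X in measurable X]setTI; exact: measurable_eval_at.
have mK := measurable_kernel translation_law _ mtA.
have fK y : translation_law y (eval_at t @^-1` A) \is a fin_num.
  exact: fin_num_measure.
have mg : measurable_fun [set: cpath R d]
    (fun w => translation_law (eval_at s w) (eval_at t @^-1` A)).
  exact: (measurableT_comp mK (measurable_eval_at _)).
split.
- move=> B mB; apply: sub_sigma_algebra; exists s => //=.
  exists ((fun y => fine (translation_law y (eval_at t @^-1` A))) @^-1` B);
    last by rewrite setTI.
  rewrite -[X in measurable X]setTI.
  have mfK := measurableT_comp (@fine_measurable R _ measurableT) mK.
  exact: mfK.
- apply: (@le_integrable _ _ _ _ _ _ _ (cst 1%E)) => //.
  + rewrite [X in measurable_fun _ X](_ : _ =
      (fun w => translation_law (eval_at s w) (eval_at t @^-1` A)))//.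
    by apply/funext => w; exact: (fineK (fK _)).
  + move=> w _; rewrite [X in `|X|%E](fineK (fK _)) gee0_abs ?measure_ge0// abse1.
    exact: (@probability_le1 _ _ _ (distribution P (translate (eval_at s w)))).
  + exact: finite_measure_integrable_cst.
move=> F cF.
have mF : measurable F := past_measurable cF.
under eq_integral do rewrite fineK//.
rewrite ge0_integral_shifted// QE//; last first.
  apply: measurableI => //; rewrite -[X in measurable X]setTI.
  exact: measurable_eval_at.
pose rs := Rplus_add r s.
pose F' : set (past rs) := shifted_path z r @^-1` F.
have mF' : measurable F' by rewrite -[X in measurable X]setTI; exact: shifted_path_past.
pose D : set (past rs * cpath R d) := (F' `*` setT) `&`
  ((fun p => z + eval_at rs p.1 + eval_at t p.2) @^-1` A).
have mD : measurable D.
  apply: measurableI; first exact: measurableX.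
  rewrite -[X in measurable X]setTI; apply: measurable_funD_rV => //; last first.
    by apply: (measurableT_comp (measurable_eval_at t)); exact: measurable_snd.
  apply: measurable_funD_rV; first exact: measurable_cst.
  by apply: (measurableT_comp (measurable_eval_at_past (lexx _)));
    exact: measurable_fst.
rewrite (_ : distribution _ _ _ = P [set w | D (w, increments_from rs w)]); last first.
  rewrite /distribution /pushforward; congr (P _).
  apply/seteqP; split=> w; rewrite /D /= /eval_at increments_fromE.
    rewrite -addrA [X in z + X]addrC subrK /rs -Rplus_addA (Rplus_addC s).
    by move=> [wA wF].
  rewrite -addrA [X in z + X]addrC subrK /rs -Rplus_addA (Rplus_addC s).
  by move=> [[wF _] wA].
rewrite increments_from_freezing// integral_mkcond; apply: eq_integral => w _.
rewrite patchE; case: ifPn => [|] wF.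
  rewrite /translation_law /distribution /pushforward; congr (P _).
  apply/seteqP; split=> v /=; rewrite /xsection/= inE /D /=.
    by move=> wA; split => //; split => //; exact: set_mem wF.
  by move=> [].
rewrite (_ : xsection D w = set0) ?measure0//.
apply/seteqP; split=> [v /xsectionP[[wF' _] _]|v []].
by move: wF; rewrite notin_setE; apply.
Qed.

End shifted_law.
End Markov.

(** * Lebesgue measure on row vectors *)

Section lebesgue_rV_theory.
Context {R : realType}.
Local Notation leb := (@lebesgue_measure R).

Definition addl (a : R) (x : measurableTypeR R) : measurableTypeR R := a + x.

Lemma measurable_addl a : measurable_fun [set: measurableTypeR R] (addl a).
Proof. by apply: measurable_funD. Qed.

HB.instance Definition _ a :=
  isMeasurableFun.Build _ _ _ _ (addl a) (measurable_addl a).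

Lemma lebesgue_measure_addl a (A : set (measurableTypeR R)) : measurable A ->
  pushforward leb (addl a) A = leb A.
Proof.
move=> mA; apply/esym.
apply: lebesgue_measure_unique => // _ [[x y] _ <-] /=.
rewrite /pushforward (_ : _ @^-1` _ = `](x - a), (y - a)]%classic); last first.
  by apply/seteqP; split=> r /=; rewrite /addl !in_itv/= ltrBlDl lerBrDl.
rewrite !lebesgue_measure_itv/= !lte_fin ltrD2r.
by case: ifP => // _; rewrite -!EFinB; congr (_%:E); ring.
Qed.

Lemma rV_consD n (a b : R) (u v : 'rV[R]_n) :
  rV_cons (a, u) + rV_cons (b, v) = rV_cons (a + b, u + v).
Proof.
apply/matrixP => i j; rewrite /rV_cons !mxE.
by case: fintype.split => k; rewrite !mxE.
Qed.

Lemma rV_consK n (v : 'rV[R]_n.+1) :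
  exists p : measurableTypeR R * 'rV[R]_n, v = rV_cons p.
Proof.
exists (@lsubmx R 1 1 n v 0 0, @rsubmx R 1 1 n v); rewrite /rV_cons.
apply: (etrans (esym (@hsubmxK R 1 1 n v))); congr (row_mx _ _).
by apply/matrixP => i j; rewrite !ord1 !mxE.
Qed.

Lemma rV_cons_head n (p : measurableTypeR R * 'rV[R]_n) :
  rV_cons p 0 (lshift n (0 : 'I_1) : 'I_n.+1) = p.1.
Proof. by rewrite [LHS]row_mxEl mxE. Qed.

Lemma rV_cons_tail n (p : measurableTypeR R * 'rV[R]_n) (i : 'I_n) :
  rV_cons p 0 (rshift 1 i : 'I_n.+1) = p.2 0 i.
Proof. by rewrite [LHS]row_mxEr. Qed.

Lemma rV_cons_inj n : injective (@rV_cons R n).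
Proof.
move=> [a u] [b v] uv; congr pair; last apply/rowP => i.
  by rewrite -[LHS](rV_cons_head (a, u)) uv rV_cons_head.
by rewrite -[LHS](rV_cons_tail (a, u)) uv rV_cons_tail.
Qed.

Lemma lebesgue_rVS n (A : set 'rV[R]_n.+1) :
  lebesgue_rV R n.+1 A =
  (\int[leb]_x lebesgue_rV R n (xsection (@rV_cons R n @^-1` A) x))%E.
Proof. by []. Qed.

Lemma measurable_rV_cons_preimage n (A : set 'rV[R]_n.+1) : measurable A ->
  measurable (@rV_cons R n @^-1` A).
Proof. by move=> mA; rewrite -[X in measurable X]setTI; exact: measurable_rV_cons. Qed.

Lemma measurable_translate_rV n (z : 'rV[R]_n) :
  measurable_fun setT (fun x : 'rV[R]_n => z + x).
Proof. by apply: measurable_funD_rV => //; exact: measurable_cst. Qed.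

(** By induction on the dimension: the sections of a translate are translates of
    sections, and the remaining integral is invariant in one dimension. *)
Lemma lebesgue_rV_translate n (z : 'rV[R]_n) (A : set 'rV[R]_n) : measurable A ->
  lebesgue_rV R n ((fun x => z + x) @^-1` A) = lebesgue_rV R n A.
Proof.
elim: n z A => [|n IH] z A mA.
  congr (lebesgue_rV R 0 _); apply/seteqP; split=> x /=;
    by rewrite (thinmx0 z) (thinmx0 x) addr0.
have [[a u] zE] := rV_consK z.
rewrite !lebesgue_rVS.
have mA' := measurable_rV_cons_preimage mA.
pose h := fun x => lebesgue_rV R n (xsection (@rV_cons R n @^-1` A) x).
have mh : measurable_fun [set: measurableTypeR R] h.
  exact: (measurable_fun_xsection (lebesgue_rV R n) mA').
transitivity (\int[leb]_x h (addl a x))%E.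
  apply: eq_integral => x _; rewrite /h -[RHS](IH u);
    last exact: (measurable_xsection _ mA').
  have key v : z + rV_cons (x, v) = rV_cons (addl a x, u + v).
    by rewrite zE rV_consD.
  congr (lebesgue_rV R n _); apply/seteqP; split=> v.
    by move=> /xsectionP xv; apply/xsectionP; rewrite /preimage /= -key.
  by move=> /xsectionP xv; apply/xsectionP; rewrite /preimage /= key.
rewrite -[RHS](@eq_measure_integral _ _ _ setT _ (pushforward leb (addl a))).
  rewrite ge0_integral_pushforward//.
by move=> B mB _; exact: lebesgue_measure_addl.
Qed.

Definition sup_box n (v : 'rV[R]_n) (e : R) : set 'rV[R]_n :=
  [set u | forall i, `|v 0 i - u 0 i| < e].

Lemma measurable_sup_box n (v : 'rV[R]_n) e : measurable (sup_box v e).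
Proof.
rewrite (_ : sup_box v e = \bigcap_(i in [set: 'I_n])
    ((fun u : 'rV[R]_n => u 0 i) @^-1` (ball (v 0 i) e))).
  apply: fin_bigcap_measurable => // i _; rewrite -[X in measurable X]setTI.
  by apply: measurable_coord_rV => //; exact: measurable_ball.
by apply/seteqP; split=> u h i; [move=> _|]; exact: h.
Qed.

Lemma lebesgue_rV_sup_box_gt0 n (v : 'rV[R]_n) e : 0 < e ->
  (0 < lebesgue_rV R n (sup_box v e))%E.
Proof.
move=> e0; elim: n v => [|n IH] v.
  rewrite /= diracE mem_set ?lte01// => -[]//.
have [[a u] ->] := rV_consK v.
rewrite -[ltRHS]/((leb \x lebesgue_rV R n)
  (@rV_cons R n @^-1` sup_box (rV_cons (a, u)) e))%E.
rewrite (_ : _ @^-1` _ = ball a e `*` sup_box u e); last first.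
  apply/seteqP; split=> -[b w] /= h.
    split=> [|i] /=.
      by have := h (lshift n (0 : 'I_1)); rewrite !rV_cons_head.
    by have := h (rshift 1 i); rewrite !rV_cons_tail.
  move=> i; have [j ->|j ->] := split_ordP (i : 'I_(1 + n)).
    by rewrite (ord1 j) !rV_cons_head; exact: h.1.
  by rewrite !rV_cons_tail; exact: h.2.
rewrite product_measure1E; [|exact: measurable_ball|exact: measurable_sup_box].
apply: mule_gt0; last exact: IH.
by rewrite [ltRHS](lebesgue_measure_ball a (ltW e0)) lte_fin mulrn_wgt0.
Qed.

Lemma lebesgue_rV_open_gt0 n (U : set 'rV[R]_n) : open U -> U !=set0 ->
  (0 < lebesgue_rV R n U)%E.
Proof.
move=> oU [v Uv].
have [e /= e0 eU] : nbhs_ball v U by apply/nbhs_ballP; exact: open_nbhs_nbhs.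
apply: lt_le_trans (lebesgue_rV_sup_box_gt0 v e0) _.
apply: le_measure; rewrite ?inE; [exact: measurable_sup_box|exact: open_measurable_rV|].
move=> u vu; apply: eU; split=> // i j; rewrite ord1; exact: vu.
Qed.

(** False in dimension 0, where the Lebesgue measure is a Dirac mass. *)
Lemma lebesgue_rV_set1 n (z : 'rV[R]_n) : (0 < n)%N -> lebesgue_rV R n [set z] = 0%E.
Proof.
case: n z => // n z _.
have [[a u] ->] := rV_consK z.
rewrite -[LHS]/((leb \x lebesgue_rV R n) (@rV_cons R n @^-1` [set rV_cons (a, u)]))%E.
rewrite (_ : _ @^-1` _ = [set a] `*` [set u]); last first.
  apply/seteqP; split=> -[b w] /=; last by move=> [-> ->].
  by move=> /rV_cons_inj[-> ->].
rewrite product_measure1E; [|exact: measurable_set1|exact: measurable_set1_rV].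
by rewrite [X in (X * _)%E](lebesgue_measure_set1 a) mul0e.
Qed.

End lebesgue_rV_theory.

(** * The heat kernel *)

Section heat_kernel.
Context {R : realType} {d : nat}.
Implicit Types (z x : 'rV[R]_d) (t : R).
Local Notation leb := (lebesgue_rV R d).

Lemma heat_kernel_ge0 z t x : 0 <= heat_kernel z t x.
Proof. by rewrite /heat_kernel mulr_ge0 ?powR_ge0 ?expR_ge0. Qed.

Lemma heat_kernel_translate z t x : heat_kernel z t (z + x) = heat_kernel 0 t x.
Proof.
rewrite /heat_kernel (eq_bigr (fun i => (x 0 i - (0 : 'rV[R]_d) 0 i) ^+ 2))// => i _.
by rewrite !mxE subr0 addrAC subrr add0r.
Qed.

Lemma continuous_heat_kernel z t : continuous (heat_kernel z t).
Proof.
pose S (x : 'rV[R]_d) := \sum_(i < d) (x 0 i - z 0 i) ^+ 2.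
have cS : continuous S.
  apply: continuous_big; first exact: add_continuous.
  move=> i _ x.
  apply: (@continuous_comp _ _ _ (fun x : 'rV[R]_d => x 0 i - z 0 i)
    (fun r : R => r ^+ 2)).
    apply: (@continuousB _ _ _ (fun y : 'rV[R]_d => y 0 i) (cst (z 0 i))).
      exact: coord_continuous_rV.
    exact: cst_continuous.
  exact: exprn_continuous.
move=> x; pose E y := - (S y / (2 * t)).
have cE : {for x, continuous E}.
  apply: (@continuousN _ _ _ (fun y => S y / (2 * t))).
  by apply: (@continuousM _ _ S (cst (2 * t)^-1)); [exact: cS|exact: cst_continuous].
apply: (@continuousM _ _ (cst ((2 * pi * t) `^ (- (d%:R / 2)))) (expR \o E)).
  exact: cst_continuous.
by apply: continuous_comp => //; exact: continuous_expR.
Qed.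

Lemma measurable_heat_kernel z t : measurable_fun [set: 'rV[R]_d] (heat_kernel z t).
Proof.
apply: (measurability _ (RGenOpens.measurableE R)).
move=> _ [_ [a [b ->] <-]]; rewrite setTI.
apply: open_measurable_rV; apply: open_comp; last exact: interval_open.
by move=> x _; exact: continuous_heat_kernel.
Qed.

(** Two densities with the same integrals agree almost everywhere, whereas the
    set where one exceeds the other is open, hence empty or of positive
    measure. *)
Let heat_kernel_le_of_integrals z t z' t' :
  leb.-integrable setT (EFin \o heat_kernel z t) ->
  (forall A : set 'rV[R]_d, measurable A ->
    \int[leb]_(x in A) (heat_kernel z t x)%:E =
    \int[leb]_(x in A) (heat_kernel z' t' x)%:E)%E ->
  forall x, heat_kernel z t x <= heat_kernel z' t' x.
Proof.
move=> int_hk hkE x; rewrite leNgt; apply/negP => hx.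
pose U := [set y | heat_kernel z' t' y < heat_kernel z t y].
have oU : open U.
  rewrite (_ : U = (heat_kernel z t \- heat_kernel z' t') @^-1` [set r | 0 < r]).
    apply: open_comp; last exact: open_gt.
    move=> y _; apply: (@continuousB _ _ _ (heat_kernel z t));
      exact: continuous_heat_kernel.
  by apply/seteqP; split=> y; rewrite /U /= subr_gt0.
have : ae_eq leb setT (EFin \o heat_kernel z t) (EFin \o heat_kernel z' t').
  apply: (integral_ae_eq measurableT int_hk).
    by apply/measurable_EFinP; exact: measurable_heat_kernel.
  by move=> E _ mE; exact: hkE.
move=> [N [mN N0 hN]].
have : (leb U <= leb N)%E.
  apply: le_measure; rewrite ?inE//; first exact: open_measurable_rV.
  move=> y Uy; apply: hN => /= /(_ I)[] yE.
  by move: Uy; rewrite /U /= yE ltxx.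
by rewrite N0 leNgt lebesgue_rV_open_gt0//; exists x.
Qed.

Lemma heat_kernel_diag z t : heat_kernel z t z = (2 * pi * t) `^ (- (d%:R / 2)).
Proof.
rewrite /heat_kernel big1 ?mul0r ?oppr0 ?expR0 ?mulr1// => i _.
by rewrite subrr expr0n.
Qed.

(** The two kernels coincide as functions.  Comparing their maxima gives the
    times; then [z] is a point where the second kernel attains its maximum, that
    is, [z']. *)
Lemma heat_kernel_inj z t z' t' : (0 < d)%N -> 0 < t -> 0 < t' ->
  leb.-integrable setT (EFin \o heat_kernel z t) ->
  (forall A : set 'rV[R]_d, measurable A ->
    \int[leb]_(x in A) (heat_kernel z t x)%:E =
    \int[leb]_(x in A) (heat_kernel z' t' x)%:E)%E ->
  t = t' /\ z = z'.
Proof.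
move=> d0 t0 t'0 ihk hkE.
have ihk' : leb.-integrable setT (EFin \o heat_kernel z' t').
  apply/integrableP; split.
    by apply/measurable_EFinP; exact: measurable_heat_kernel.
  move/integrableP: ihk => [_].
  under eq_integral do rewrite /= ger0_norm ?heat_kernel_ge0//.
  under [X in _ -> (X < _)%E]eq_integral do rewrite /= ger0_norm ?heat_kernel_ge0//.
  by rewrite hkE.
have E x : heat_kernel z t x = heat_kernel z' t' x.
  apply/eqP; rewrite eq_le (heat_kernel_le_of_integrals ihk hkE)/=.
  by apply: (heat_kernel_le_of_integrals ihk') => A mA; rewrite hkE.
have c_gt0 s : 0 < s -> 0 < (2 * pi * s) `^ (- (d%:R / 2)) :> R.
  by move=> s0; rewrite powR_gt0// !mulr_gt0// pi_gt0.
have le_diag y s x : 0 < s -> heat_kernel y s x <= (2 * pi * s) `^ (- (d%:R / 2)).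
  move=> s0; rewrite /heat_kernel ger_pMr ?c_gt0// -expR0 ler_expR oppr_le0.
  rewrite divr_ge0//; last by rewrite mulr_ge0// ltW.
  by apply: sumr_ge0 => i _; exact: sqr_ge0.
have cE : (2 * pi * t) `^ (- (d%:R / 2)) = (2 * pi * t') `^ (- (d%:R / 2)).
  apply/eqP; rewrite eq_le -{1}(heat_kernel_diag z) E le_diag//=.
  by rewrite -(heat_kernel_diag z') -E le_diag.
split.
  move: cE; rewrite !powRN => /invr_inj.
  move/powR_injective => /(_ _)/wrap[]; first by rewrite divr_gt0// ltr0n.
  move=> /(_ _ _)/wrap[]; rewrite ?nnegrE ?mulr_ge0 ?pi_ge0 ?ltW// => h.
  have pi20 : 2 * pi != 0 :> R by rewrite mulf_neq0// gt_eqF// pi_gt0.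
  exact: (mulfI pi20).
set c := (2 * pi * t') `^ _ in cE.
pose S := \sum_(i < d) (z 0 i - z' 0 i) ^+ 2.
have e1 : expR (- (S / (2 * t'))) = 1.
  have c0 : c != 0 by rewrite gt_eqF// c_gt0.
  apply: (mulfI c0); rewrite mulr1.
  by have := E z; rewrite heat_kernel_diag cE /heat_kernel -/S -/c => <-.
have /eqP : - (S / (2 * t')) = 0 by apply: expR_inj; rewrite e1 expR0.
rewrite oppr_eq0 mulf_eq0 invr_eq0 [X in _ || X]gt_eqF ?mulr_gt0// orbF.
rewrite psumr_eq0; last by move=> i _; exact: sqr_ge0.
move=> /allP h; apply/rowP => i.
by have := h i (mem_index_enum _); rewrite sqrf_eq0 subr_eq0 => /eqP.
Qed.

Definition addl_rV z x := z + x.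

HB.instance Definition _ z :=
  isMeasurableFun.Build _ _ _ _ (addl_rV z) (measurable_translate_rV z).

Lemma Brownian_density (P : probability (cpath R d) R) z (s : Rplus R)
    (A : set 'rV[R]_d) :
  Brownian_law P -> 0 < set_val s -> measurable A ->
  P [set w | A (z + eval_at s w)] =
  (\int[leb]_(x in A) (heat_kernel z (set_val s) x)%:E)%E.
Proof.
move=> BM s0 mA.
have mT := measurable_translate_rV z measurableT mA; rewrite setTI in mT.
transitivity (P [set w | (addl_rV z @^-1` A) (eval_at s w - eval_at (Rplus0 R) w)]).
  apply: (measure_eq_mod_null (measurable_start 0) (Brownian_start_null BM)).
  - rewrite -[X in measurable X]setTI.
    exact: (measurableT_comp (measurable_translate_rV z) (measurable_eval_at s)).
  - rewrite -[X in measurable X]setTI; exact: (measurable_increment (Rplus0 R) s).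
  - apply/seteqP; split=> w [Aw w0]; split => //; move: Aw;
      by rewrite /= (w0 : eval_at (Rplus0 R) w = 0) subr0.
have [_ h _] := BM.
apply: (etrans (h (Rplus0 R) s s0 _ mT)); rewrite /= subr0.
rewrite -[RHS](@eq_measure_integral _ _ _ _ _
  (pushforward leb (addl_rV z))); last first.
  by move=> B mB _; exact: lebesgue_rV_translate.
apply/esym; apply: (etrans (ge0_integral_pushforward _ _ mA _ _)).
- exact: measurable_translate_rV.
- apply/measurable_EFinP.
  exact: (measurable_funS measurableT (@subsetT _ _) (measurable_heat_kernel _ _)).
- by move=> x _; rewrite lee_fin heat_kernel_ge0.
- by apply: eq_integral => x _; rewrite /= heat_kernel_translate.
Qed.

End heat_kernel.

(** * Marginals of the Wiener measures and the core property *)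

Section marginals.
Context {R : realType} {d : nat} {disp : measure_display}.
Context {Omega : measurableType disp} {Pr : probability Omega R}.
Variable W : {RV Pr >-> cpath R d}.
Hypothesis W_BM : standard_Brownian_motion W.

Definition Brownian_marginal (t : Rplus R) (z : 'rV[R]_d) : probability 'rV[R]_d R :=
  marginal (started_at W z) t.

Let P := distribution Pr W.
Let BM : Brownian_law P := Brownian_law_distribution W_BM.

Lemma Brownian_marginal0 z : same_law (Brownian_marginal (Rplus0 R) z) (\d_z).
Proof.
move=> A mA; rewrite -[LHS]/(P [set w | A (z + eval_at (Rplus0 R) w)]).
have mZ : measurable [set w : cpath R d | A (z + eval_at (Rplus0 R) w)].
  rewrite -[X in measurable X]setTI.
  exact: (measurableT_comp (measurable_translate_rV z) (measurable_eval_at _)).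
have start (w : cpath R d) : w (Rplus0 R) = 0 -> z + eval_at (Rplus0 R) w = z.
  by move=> w0; rewrite (w0 : eval_at (Rplus0 R) w = 0) addr0.
rewrite diracE; have [Az|nAz] := pselect (A z).
  rewrite mem_set// -[RHS](@probability_setT _ _ _ P).
  apply: (measure_eq_mod_null (measurable_start 0) (Brownian_start_null BM)) => //.
  by apply/seteqP; split=> w [_ w0]; split => //=; rewrite start.
rewrite memNset// -[RHS](@measure0 _ _ _ P).
apply: (measure_eq_mod_null (measurable_start 0) (Brownian_start_null BM)) => //.
by apply/seteqP; split=> w [] //= Aw w0; move: Aw; rewrite start.
Qed.

Lemma Brownian_marginal_density (t : Rplus R) z : 0 < set_val t ->
  same_law (Brownian_marginal t z)
    (fun A => \int[lebesgue_rV R d]_(x in A) (heat_kernel z (set_val t) x)%:E)%E.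
Proof. by move=> t0 A mA; exact: (Brownian_density z BM t0 mA). Qed.

(** At positive times the densities determine time and starting point; a marginal
    at time 0 charges a point, which one at a positive time cannot do. *)
Lemma Brownian_marginal_inj (d_gt0 : (0 < d)%N) t z t' z' :
  same_law (Brownian_marginal t z) (Brownian_marginal t' z') -> t = t' /\ z = z'.
Proof.
have ge0 (s : Rplus R) : 0 <= set_val s := set_valP s.
have dirac_ne s x y : 0 < set_val s -> ~ same_law (\d_x) (Brownian_marginal s y).
  move=> s0 /(_ [set x] (measurable_set1_rV x)).
  rewrite (Brownian_marginal_density y s0 (measurable_set1_rV x)) null_set_integral.
  - by rewrite diracE mem_set// => /eqP; rewrite onee_eq0.
  - exact: measurable_set1_rV.
  - apply/measurable_EFinP.
    exact: (measurable_funS measurableT (@subsetT _ _) (measurable_heat_kernel _ _)).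
  - exact: lebesgue_rV_set1.
have [t0|t0] := eqVneq (set_val t) 0; have [t'0|t'0] := eqVneq (set_val t') 0 => h.
- have tE : Rplus0 R = t by apply: val_inj.
  have t'E : Rplus0 R = t' by apply: val_inj.
  split; first by rewrite -tE -t'E.
  have := h _ (measurable_set1_rV z).
  rewrite -tE -t'E (Brownian_marginal0 z (measurable_set1_rV z)).
  rewrite (Brownian_marginal0 z' (measurable_set1_rV z)) !diracE mem_set//.
  have [/eqP zz'|zz'] := pselect (z' == z); first by [].
  by rewrite memNset => [/eqP|/= /eqP//]; rewrite onee_eq0.
- have tE : Rplus0 R = t by apply: val_inj.
  exfalso; apply: (dirac_ne t' z z'); first by rewrite lt_neqAle eq_sym t'0 ge0.
  by move=> A mA; rewrite -(Brownian_marginal0 z mA) tE h.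
- have tE : Rplus0 R = t' by apply: val_inj.
  exfalso; apply: (dirac_ne t z' z); first by rewrite lt_neqAle eq_sym t0 ge0.
  by move=> A mA; rewrite -(Brownian_marginal0 z' mA) tE h.
- have {}t0 : 0 < set_val t by rewrite lt_neqAle eq_sym t0 ge0.
  have {}t'0 : 0 < set_val t' by rewrite lt_neqAle eq_sym t'0 ge0.
  have [] := @heat_kernel_inj R d z (set_val t) z' (set_val t') d_gt0 t0 t'0.
  + apply/integrableP; split.
      by apply/measurable_EFinP; exact: measurable_heat_kernel.
    under eq_integral do rewrite /= ger0_norm ?heat_kernel_ge0//.
    rewrite -(Brownian_marginal_density z t0 measurableT).
    exact: fin_num_fun_lty.
  + move=> A mA; rewrite -(Brownian_marginal_density z t0 mA) h//.
    exact: Brownian_marginal_density.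
  + by move=> /val_inj -> ->.
Qed.

Definition Brownian_laws : set (probability 'rV[R]_d R) :=
  [set Brownian_marginal tz.1 tz.2 | tz in [set: Rplus R * 'rV[R]_d]].

(** All initial laws share the same disintegration kernel. *)
Lemma Brownian_nonlinear_Markov_process
    (Q : probability 'rV[R]_d R -> probability (cpath R d) R) :
  (forall t z, same_law (Q (Brownian_marginal t z))
     (distribution (started_at W z) (@time_shift R d t))) ->
  nonlinear_Markov_process Brownian_laws Q.
Proof.
move=> QE.
have QP t z : same_law (Q (Brownian_marginal t z)) (distribution P (shifted_path z t)).
  exact: QE.
have marg s t z A : measurable A ->
    marginal (Q (Brownian_marginal t z)) s A = Brownian_marginal (Rplus_add t s) z A.
  move=> mA; apply: QE; rewrite -[X in measurable X]setTI.
  exact: measurable_eval_at.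
split.
- move=> _ [[t z] _ <-] A mA /=.
  by rewrite marg// Rplus_addr0.
- move=> _ s [[t z] _ <-] _; exists (Brownian_marginal (Rplus_add t s) z).
    by exists (Rplus_add t s, z).
  by move=> A mA; exact: marg.
- exists (fun=> translation_law P : R.-pker _ ~> _); split.
    by move=> _ [[t z] _ <-]; exact: (shifted_disintegration BM (QP t z)).
  move=> s t _ eta A [[r z] _ <-] _ _ mA.
  exists (fun w => fine (translation_law P (eval_at s w) (eval_at t @^-1` A))).
    exact: (shifted_cond_probability BM (QP r z)).
  apply: aeW => w; rewrite fineK//.
  apply: (fin_num_measure (distribution P (translate (eval_at s w)))).
  by rewrite -[X in measurable X]setTI; exact: measurable_eval_at.
Qed.

End marginals.

Theorem proposition5p1 (R : realType) (d : nat) (d_gt0 : (0 < d)%N)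
    (disp : measure_display) (Omega : measurableType disp)
    (Pr : probability Omega R) (W : {RV Pr >-> cpath R d})
    (W_BM : standard_Brownian_motion W) :
  nonlinear_Markov_core_density (@heat_kernel R d)
    (fun z : 'rV[R]_d => started_at W z).
Proof.
exists (Brownian_marginal W).
have mu_inj := Brownian_marginal_inj W_BM d_gt0.
split; [exact: Brownian_marginal0|exact: Brownian_marginal_density|].
split; [exact: Brownian_marginal0|exact: mu_inj|by []|].
(* Injectivity makes the law prescribed for a given marginal independent of the
   pair [(t, z)] that represents it. *)
have /choice[Q QE] : forall zeta : probability 'rV[R]_d R,
    exists q : probability (cpath R d) R, forall t z,
      zeta = Brownian_marginal W t z ->
      same_law q (distribution (started_at W z) (@time_shift R d t)).
  move=> zeta.
  have [[[t z] ->]|no] := pselect (exists tz, zeta = Brownian_marginal W tz.1 tz.2).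
    exists (distribution (started_at W z) (@time_shift R d t)) => t' z' mu_eq.
    by have [|-> ->] := mu_inj t z t' z'; first by rewrite -mu_eq.
  exists (started_at W 0) => t z zetaE.
  by exfalso; apply: no; exists (t, z).
exists Q; split; first by move=> t z; exact: QE.
by apply: Brownian_nonlinear_Markov_process => // t z; exact: QE.
Qed.
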